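(* Let $p\ge 1$ be a real number, let $H$ be a finitely generated amenable group, let $s\ge 1$ be an integer and let $F$ be a non-trivial finite group. Let $\mathsf{P}$ denote either the lampjuggler construction $\mathsf{P}(\cdot)=\mathsf{Shuffler}_s(\cdot)$ or the lampdesigner construction $\mathsf{P}(\cdot)=\mathsf{Designer}_F(\cdot)$, with iterates $\mathsf{P}^{\circ 0}(H)=H$ and $\mathsf{P}^{\circ n}(H)=\mathsf{P}(\mathsf{P}^{\circ(n-1)}(H))$ for $n\geq 1$. (A) If $j_{p,H}$ satisfies Assumption $(\star)$, then $$j_{p,H}\left(\frac{\ln(x)}{\ln(\ln(x))}\right)\preccurlyeq j_{p,\mathsf{P}(H)}(x)\preccurlyeq j_{1,H}(\ln(x)).$$ (B) Let $n\ge 0$ be an integer and assume that $j_{p,H}(x)\simeq j_{1,H}(x)$. - If $H$ has polynomial growth of degree $d\ge 1$ and $n\ge 1$, then $$j_{p,\mathsf{P}^{\circ n}(H)}(x)\simeq\left(\frac{\ln^{\circ n}(x)}{\ln^{\circ(n+1)}(x)}\right)^{\frac1d}.$$ - If $j_{p,H}$ satisfies Assumption $(\star)$ and $j_{p,H}\left(\frac{x}{\ln(x)}\right)\simeq j_{p,H}(x)$, then $$j_{p,\mathsf{P}^{\circ n}(H)}(x)\simeq j_{p,H}(\ln^{\circ n}(x)).$$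
   Context: Groups: for a set $X$, $\mathsf{FSym}(X)$ is the group of finitely supported bijections of $X$. Lampjuggler: $\mathsf{Shuffler}_s(H)=\mathsf{FSym}(H\times\{1,\dots,s\})\rtimes H$, where $H$ acts on $\mathsf{FSym}(H\times\{1,\dots,s\})$ through $h\cdot(x,i)=(hx,i)$, i.e. by $(h\cdot\sigma)(y)=h\cdot\sigma(h^{-1}\cdot y)$. Lampdesigner: $\mathsf{Designer}_F(H)=(F\wr_H\mathsf{FSym}(H))\rtimes H$, where $F\wr_H\mathsf{FSym}(H)=(\bigoplus_H F)\rtimes\mathsf{FSym}(H)$ is the permutational wreath product, and $H$ acts on $\bigoplus_H F$ by permuting coordinates through left multiplication and on $\mathsf{FSym}(H)$ by $(h\cdot\sigma)(x)=h\sigma(h^{-1}x)$. Isoperimetric profile: for a finitely generated group $G$ with finite generating set $S_G$ and a real $p\ge 1$, $j_{p,G}(x)=\sup \|f\|_p/\|\nabla f\|_p$, the supremum being over (nonzero) functions $f\colon G\to\mathbb{R}_+$ with $|\mathrm{supp}\, f|\le x$, where $\|\nabla f\|_p^p=\sum_{g\in G,\,s\in S_G}|f(g)-f(gs)|^p$. Up to the relation $\simeq$ below it does not depend on $S_G$. Asymptotic comparison: for non-decreasing functions, $f\preccurlyeq g$ means that there is $C>0$ such that $f(x)=O(g(Cx))$ as $x\to+\infty$; $f\simeq g$ means $f\preccurlyeq g$ and $g\preccurlyeq f$. Expressions are considered for $x$ large enough. $\ln^{\circ n}$ is the $n$-fold iterate of $\ln$. Assumption $(\star)$: a non-decreasing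 function $h$ satisfies Assumption $(\star)$ if for every $C>0$, $h(Cx)=O(h(x))$ as $x\to+\infty$. *)

(* Defs.v *)
From HB Require Import structures.
From mathcomp Require Import all_boot finmap fingroup all_order all_algebra.
From mathcomp Require Import all_classical all_reals all_analysis.

Set Implicit Arguments.
Unset Strict Implicit.
Unset Printing Implicit Defensive.

Import Order.TTheory GRing.Theory Num.Theory.

Local Open Scope classical_set_scope.
Local Open Scope group_scope.

Record laction (H : groupType) (X : Type) := LAction {
  lact :> H -> X -> X;
  lact1 : forall x, lact 1 x = x;
  lactM : forall g h x, lact (g * h) x = lact g (lact h x) }.

Record autaction (H N : groupType) := AutAction {
  aact :> laction H N;
  aactMr : forall h m n, aact h (m * n) = aact h m * aact h n }.

Section LActionTheory.
Variables (H : groupType) (X : Type) (a : laction H X).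

Lemma lactK h : cancel (a h) (a h^-1).
Proof. by move=> x; rewrite -lactM mulVg lact1. Qed.

Lemma lactVK h : cancel (a h^-1) (a h).
Proof. by move=> x; rewrite -lactM mulgV lact1. Qed.

End LActionTheory.

Lemma aactr1 (H N : groupType) (a : autaction H N) h : a h 1 = 1.
Proof. by apply: (@mulgI _ (a h 1)); rewrite -aactMr !mulg1. Qed.

Record sdprod (H N : groupType) (a : autaction H N) :=
  SDProd { sdl : N; sdr : H }.

Section SemidirectProduct.
Variables (H N : groupType) (a : autaction H N).
Local Notation G := (sdprod a).

HB.instance Definition _ := gen_eqMixin G.
HB.instance Definition _ := gen_choiceMixin G.

Definition sd_one : G := SDProd a 1 1.
Definition sd_inv (u : G) : G := SDProd a (a (sdr u)^-1 (sdl u)^-1) (sdr u)^-1.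
Definition sd_mul (u v : G) : G :=
  SDProd a (sdl u * a (sdr u) (sdl v)) (sdr u * sdr v).

Fact sd_mulA : associative sd_mul.
Proof.
by move=> u v w; rewrite /sd_mul /= aactMr lactM !mulgA.
Qed.

Fact sd_mul1 : left_id sd_one sd_mul.
Proof. by case=> n h; rewrite /sd_mul /= lact1 !mul1g. Qed.

Fact sd_mulr1 : right_id sd_one sd_mul.
Proof. by case=> n h; rewrite /sd_mul /= aactr1 !mulg1. Qed.

Fact sd_mulV : left_inverse sd_one sd_inv sd_mul.
Proof.
by case=> n h; rewrite /sd_mul /sd_inv /= -aactMr !mulVg aactr1.
Qed.

Fact sd_mulrV : right_inverse sd_one sd_inv sd_mul.
Proof. by case=> n h; rewrite /sd_mul /sd_inv /= lactVK !mulgV. Qed.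

HB.instance Definition _ :=
  isGroup.Build G sd_mulA sd_mul1 sd_mulr1 sd_mulV sd_mulrV.

End SemidirectProduct.

(* The inverse is part of the data, but it is determined by [fs_fun]. *)
Record FSym (X : Type) := MkFSym {
  fs_fun :> X -> X;
  fs_inv : X -> X;
  fs_funK : cancel fs_fun fs_inv;
  fs_invK : cancel fs_inv fs_fun;
  fs_fin : finite_set [set x | fs_fun x <> x] }.

Section FSymGroup.
Variable X : Type.
Local Notation G := (FSym X).

Lemma fsymP (s t : G) : (forall x, s x = t x) -> s = t.
Proof.
case: s t => [f f' fK f'K fF] [g g' gK g'K gF] /= /funext fg.
have fg' : f' = g'.
  by apply/funext => x; rewrite -[x in LHS]g'K -fg fK.
by subst g g'; congr MkFSym; exact: Prop_irrelevance.
Qed.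

HB.instance Definition _ := gen_eqMixin G.
HB.instance Definition _ := gen_choiceMixin G.

Fact fs_one_fin : finite_set [set x : X | id x <> x].
Proof. by apply: (sub_finite_set _ (finite_set0 X)) => x /= /(_ erefl). Qed.

Definition fs_one : G := @MkFSym X id id (fun=> erefl) (fun=> erefl) fs_one_fin.

Fact fs_inv_fin (s : G) : finite_set [set x | fs_inv s x <> x].
Proof.
apply: (sub_finite_set _ (fs_fin s)) => x /= sx sx'.
by apply: sx; rewrite -[x in LHS]sx' fs_funK.
Qed.

Definition fs_invg (s : G) : G := MkFSym (fs_invK s) (fs_funK s) (fs_inv_fin s).

Fact fs_mul_fin (s t : G) : finite_set [set x | (s \o t) x <> x].
Proof.
have := conj (fs_fin s) (fs_fin t); rewrite -finite_setU.
apply: sub_finite_set => x /= stx.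
by have [tx|] := pselect (t x = x); [left; rewrite -[x in s x]tx | right].
Qed.

Definition fs_mul (s t : G) : G :=
  MkFSym (can_comp (fs_funK s) (fs_funK t)) (can_comp (fs_invK t) (fs_invK s))
    (fs_mul_fin s t).

Fact fs_mulA : associative fs_mul. Proof. by move=> s t u; exact: fsymP. Qed.
Fact fs_mul1 : left_id fs_one fs_mul. Proof. by move=> s; exact: fsymP. Qed.
Fact fs_mulr1 : right_id fs_one fs_mul. Proof. by move=> s; exact: fsymP. Qed.
Fact fs_mulV : left_inverse fs_one fs_invg fs_mul.
Proof. by move=> s; apply: fsymP => x; exact: fs_funK. Qed.
Fact fs_mulrV : right_inverse fs_one fs_invg fs_mul.
Proof. by move=> s; apply: fsymP => x; exact: fs_invK. Qed.

HB.instance Definition _ :=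
  isGroup.Build G fs_mulA fs_mul1 fs_mulr1 fs_mulV fs_mulrV.

Definition fsym_laction : laction G X :=
  @LAction G X (fun s => s) (fun=> erefl) (fun _ _ _ => erefl).

End FSymGroup.

Section FSymConj.
Variables (H : groupType) (X : Type) (a : laction H X).

Fact fs_conjK h (s : FSym X) :
  cancel (fun x => a h (s (a h^-1 x))) (fun x => a h (fs_inv s (a h^-1 x))).
Proof. by move=> x; rewrite lactK fs_funK lactVK. Qed.

Fact fs_conjVK h (s : FSym X) :
  cancel (fun x => a h (fs_inv s (a h^-1 x))) (fun x => a h (s (a h^-1 x))).
Proof. by move=> x; rewrite lactK fs_invK lactVK. Qed.

Fact fs_conj_fin h (s : FSym X) :
  finite_set [set x | a h (s (a h^-1 x)) <> x].
Proof.
apply: (sub_finite_set _ (finite_image (a h) (fs_fin s))) => x /= sx.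
exists (a h^-1 x); last exact: lactVK.
by move=> e; apply: sx; rewrite e lactVK.
Qed.

Definition fs_conj (h : H) (s : FSym X) : FSym X :=
  MkFSym (fs_conjK h s) (fs_conjVK h s) (fs_conj_fin h s).

Fact fs_conj1 s : fs_conj 1 s = s.
Proof. by apply: fsymP => x /=; rewrite invg1 !lact1. Qed.

Fact fs_conjM g h s : fs_conj (g * h) s = fs_conj g (fs_conj h s).
Proof. by apply: fsymP => x /=; rewrite invgM !lactM. Qed.

Fact fs_conjMr h s t : fs_conj h (s * t) = fs_conj h s * fs_conj h t.
Proof. by apply: fsymP => x /=; rewrite lactK. Qed.

Definition fsym_autaction : autaction H (FSym X) :=
  @AutAction H (FSym X) (LAction fs_conj1 fs_conjM) fs_conjMr.

End FSymConj.

Record dsum (X : Type) (F : groupType) := DSum {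
  ds_fun :> X -> F;
  ds_fin : finite_set [set x | ds_fun x <> 1] }.

Section DSumGroup.
Variables (X : Type) (F : groupType).
Local Notation G := (dsum X F).

Lemma dsumP (f g : G) : (forall x, f x = g x) -> f = g.
Proof.
case: f g => [f fF] [g gF] /= /funext fg.
by subst g; congr DSum; exact: Prop_irrelevance.
Qed.

HB.instance Definition _ := gen_eqMixin G.
HB.instance Definition _ := gen_choiceMixin G.

Fact ds_one_fin : finite_set [set x : X | (1 : F) <> 1].
Proof. by apply: (sub_finite_set _ (finite_set0 X)) => x /= /(_ erefl). Qed.

Definition ds_one : G := DSum ds_one_fin.

Fact ds_inv_fin (f : G) : finite_set [set x | (f x)^-1 <> 1].
Proof.
apply: (sub_finite_set _ (ds_fin f)) => x /= fx fx1.
by apply: fx; rewrite fx1 invg1.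
Qed.

Definition ds_inv (f : G) : G := DSum (ds_inv_fin f).

Fact ds_mul_fin (f g : G) : finite_set [set x | f x * g x <> 1].
Proof.
have := conj (ds_fin f) (ds_fin g); rewrite -finite_setU.
apply: sub_finite_set => x /= fgx.
have [fx|] := pselect (f x = 1); [right=> gx | by left].
by apply: fgx; rewrite fx gx mulg1.
Qed.

Definition ds_mul (f g : G) : G := DSum (ds_mul_fin f g).

Fact ds_mulA : associative ds_mul.
Proof. by move=> f g h; apply: dsumP => x; exact: mulgA. Qed.
Fact ds_mul1 : left_id ds_one ds_mul.
Proof. by move=> f; apply: dsumP => x; exact: mul1g. Qed.
Fact ds_mulr1 : right_id ds_one ds_mul.
Proof. by move=> f; apply: dsumP => x; exact: mulg1. Qed.
Fact ds_mulV : left_inverse ds_one ds_inv ds_mul.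
Proof. by move=> f; apply: dsumP => x; exact: mulVg. Qed.
Fact ds_mulrV : right_inverse ds_one ds_inv ds_mul.
Proof. by move=> f; apply: dsumP => x; exact: mulgV. Qed.

HB.instance Definition _ :=
  isGroup.Build G ds_mulA ds_mul1 ds_mulr1 ds_mulV ds_mulrV.

End DSumGroup.

Section DSumAction.
Variables (H : groupType) (X : Type) (F : groupType) (a : laction H X).

Fact ds_act_fin h (f : dsum X F) : finite_set [set x | f (a h^-1 x) <> 1].
Proof.
apply: (sub_finite_set _ (finite_image (a h) (ds_fin f))) => x /= fx.
by exists (a h^-1 x) => //; exact: lactVK.
Qed.

Definition ds_act (h : H) (f : dsum X F) : dsum X F := DSum (ds_act_fin h f).

Fact ds_act1 f : ds_act 1 f = f.
Proof. by apply: dsumP => x /=; rewrite invg1 lact1. Qed.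

Fact ds_actM g h f : ds_act (g * h) f = ds_act g (ds_act h f).
Proof. by apply: dsumP => x /=; rewrite invgM lactM. Qed.

Fact ds_actMr h f g : ds_act h (f * g) = ds_act h f * ds_act h g.
Proof. exact: dsumP. Qed.

Definition dsum_autaction : autaction H (dsum X F) :=
  @AutAction H (dsum X F) (LAction ds_act1 ds_actM) ds_actMr.

End DSumAction.

Section Shuffler.
Variables (s : nat) (H : groupType).

Definition lmul_sheets (h : H) (xi : H * 'I_s) : H * 'I_s := (h * xi.1, xi.2).

Fact lmul_sheets1 xi : lmul_sheets 1 xi = xi.
Proof. by case: xi => x i; rewrite /lmul_sheets mul1g. Qed.

Fact lmul_sheetsM g h xi :
  lmul_sheets (g * h) xi = lmul_sheets g (lmul_sheets h xi).
Proof. by rewrite /lmul_sheets /= mulgA. Qed.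

Definition Shuffler : groupType :=
  sdprod (fsym_autaction (LAction lmul_sheets1 lmul_sheetsM)).

End Shuffler.

Definition fsym_wreath (F : groupType) (X : Type) : groupType :=
  sdprod (dsum_autaction F (fsym_laction X)).

Section Designer.
Variables (F H : groupType).
Local Notation W := (fsym_wreath F H).

Definition lmul_laction : laction H H :=
  LAction (@mul1g H) (fun g h x => esym (mulgA g h x)).

Definition wreath_act (h : H) (w : W) : W :=
  SDProd _ (dsum_autaction F lmul_laction h (sdl w))
    (fsym_autaction lmul_laction h (sdr w)).

Fact wreath_act1 w : wreath_act 1 w = w.
Proof. by case: w => f s; rewrite /wreath_act !lact1. Qed.

Fact wreath_actM g h w : wreath_act (g * h) w = wreath_act g (wreath_act h w).
Proof. by rewrite /wreath_act !lactM. Qed.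

Fact wreath_actMr h v w :
  wreath_act h (v * w) = wreath_act h v * wreath_act h w.
Proof.
rewrite {1}/wreath_act !aactMr; congr SDProd; congr (_ * _).
by apply: dsumP => x /=; rewrite mulKg.
Qed.

Definition Designer : groupType :=
  sdprod (@AutAction H W (LAction wreath_act1 wreath_actM) wreath_actMr).

End Designer.

Section Generation.
Variables (G : groupType) (S : {fset G}).

Definition word_ball (n : nat) : set G :=
  [set g | exists w : seq G,
    [/\ (size w <= n)%N, all (fun t => (t \in S) || (t^-1 \in S)) w
      & g = \prod_(t <- w) t]].

Definition generates : Prop := forall g, exists n, word_ball n g.

End Generation.

(* [fset_set] is empty on infinite sets: [card_set] is meaningful on finite ones,
   such as word balls. *)
Definition card_set (G : groupType) (A : set G) : nat := #|` fset_set A|.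

Local Open Scope ring_scope.

(* The Folner condition, for right translations, as in the word metric and the
   gradient below. *)
Definition amenable (R : realType) (G : groupType) : Prop :=
  forall (K : {fset G}) (e : R), 0 < e -> exists A : {fset G},
    A != fset0%fset /\
    forall k, k \in K ->
      (#|` [fset x in A | (x * k)%g \notin A]%fset|)%:R <= e * (#|` A|)%:R.

Definition polynomial_growth (R : realType) (G : groupType) (S : {fset G})
    (d : nat) : Prop :=
  exists c C : R, [/\ 0 < c, 0 < C & forall n : nat, (0 < n)%N ->
    c * n%:R ^+ d <= (card_set (word_ball S n))%:R <= C * n%:R ^+ d].

Section Profile.
Variables (R : realType) (G : groupType).
Implicit Types (p x : R) (S : {fset G}) (f : G -> R).

Definition supp f : set G := [set g | f g != 0].

(* The sums below range over finite supports, and are used only for finitely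
   supported f. *)
Definition norm_p p f : R := (\sum_(g \in [set: G]) `|f g| `^ p) `^ p^-1.

Definition grad_p p S f : R :=
  (\sum_(g \in [set: G]) \sum_(t <- S) `|f g - f (g * t)%g| `^ p) `^ p^-1.

Definition admissible x f : Prop :=
  [/\ forall g, 0 <= f g, exists g, f g != 0, finite_set (supp f)
    & (card_set (supp f))%:R <= x].

(* In [\bar R] the inverse of 0 is +oo: on a finite group, where constant
   functions have zero gradient, the profile is eventually +oo. *)
Definition profile p S x : \bar R :=
  ereal_sup [set ((norm_p p f)%:E / (grad_p p S f)%:E)%E | f in admissible x].

End Profile.

Section Comparison.
Variable R : realType.
Implicit Types f g h : R -> \bar R.

(* The library's Landau notations do not cover functions valued in [\bar R]. *)
Definition bigO_pinfty f g : Prop :=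
  exists K : R, 0 < K /\ \forall x \near +oo, (`|f x| <= K%:E * `|g x|)%E.

Definition asymp_le f g : Prop :=
  exists C : R, 0 < C /\ bigO_pinfty f (fun x => g (C * x)).

Definition asymp_eq f g : Prop := asymp_le f g /\ asymp_le g f.

Definition assumption_star h : Prop :=
  forall C : R, 0 < C -> bigO_pinfty (fun x => h (C * x)) h.

End Comparison.

(* Main.v *)
Require Import Defs.
From mathcomp Require Import all_boot finmap fingroup all_order all_algebra.
From mathcomp Require Import all_classical all_reals all_analysis.
From mathcomp Require Import zify ring lra.

Set Implicit Arguments.
Unset Strict Implicit.
Unset Printing Implicit Defensive.

Import Order.TTheory GRing.Theory Num.Theory.
Import numFieldNormedType.Exports.
Local Open Scope classical_set_scope.
Local Open Scope ring_scope.

(** Write [j_G] for the isoperimetric profile and let [G = N ><| H] be a lampjuggler or lampdesigner group over [H].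

Lower bound: a function [f] on [H] supported by [n] points extends to the pairs [(nu, h)] where [nu] moves only points near the support of [f]; there are at most [(D n)^(D n)] such [nu], hence [j_H n] is at most a constant times [j_G ((D n)^(D n))].

Upper bound: let [A] be a finite subset of [G] with small boundary, and cut it into slices [{h | (nu, h) in A}].  Most slices have small boundary in [H], hence more than [m] points as soon as [j_H m <= r].  The transposition of [h] and [h y] is a word of length linear in [|y|], so for [|y| <= r] most elements of [A] stay in [A] under it.  After discarding the bad slices, every remaining configuration has about [m] positions, each of which can receive about [b] different labels, [b] being proportional to the volume of the ball of radius [r]; freezing these positions one at a time yields [b^(c m)] configurations, so [A] has at least [b^(c m)] elements.  An arbitrarily large constant [b] is what removes the constants inside the logarithm; under polynomial growth of degree [d], [b] is comparable to [m] when [r] is [m^(1/d)], which yields the sharp bound. *)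

(** * Boundaries of finite sets *)

(** Counting slices and configurations works with sets, hence with exponent 1. The upper bound is
    therefore proved and iterated for [profile 1]; [profile p] is compared with it once, in the top
    group, and one returns to [p] only in [H], through the equivalence assumed in (B). The lower
    bound holds for every [p] directly, since the gradient of the extended function is controlled
    fibre by fibre by that of [f]. The obstacle is a constant inside an argument: it is harmless for
    [profile p SH] under Assumption star, and for powers by homogeneity, but (A) assumes nothing of
    the kind on [profile 1 SH]. Hence an upper bound at exactly [ln x], and comparisons without
    dilation during the iteration. The lower bound loses a factor [D * ln (ln x)]. Only the
    extension directly above [H] really pays for it: one more logarithm turns it into a bounded
    factor. Both constructions enter through two short lists of properties, one of swaps and one of
    finitely carried elements. *)

Lemma card_fimage_inj (T T' : choiceType) (f : T -> T') (A : {fset T}) :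
  {in A &, injective f} -> #|` [fset f x | x in A]%fset| = #|` A|.
Proof. by move=> fI; apply: (@card_in_imfset imfset_key _ _ f (mem A)) => x y; exact: fI. Qed.

Lemma card_fimage (T T' : choiceType) (f : T -> T') (A : {fset T}) :
  (#|` [fset f x | x in A]%fset| <= #|` A|)%N.
Proof. exact: leq_imfset_card. Qed.

Section Boundary.
Variable G : groupType.
Implicit Types (A B S : {fset G}) (g v w : G).

Definition bd A w : nat := #|` [fset g in A | (g * w)%g \notin A]%fset|.

Definition bdS A S : nat := \sum_(t <- S) bd A t.

(** This is [profile 1 S x <= r] tested on indicators: along each generator as many points enter [A]
    as leave it, so the gradient of the indicator is twice the boundary, whence the factor 2.
    [coarea] recovers all functions. *)
Definition isoper (R : realType) S (x r : R) : Prop :=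
  forall A, #|` A|%:R <= x -> #|` A|%:R <= 2 * r * (bdS A S)%:R.

Lemma bd_cardE A w : (bd A w + #|` [fset g in A | (g * w)%g \in A]%fset|)%N = #|` A|.
Proof.
rewrite addnC /bd -(cardfsID [fset g | g in A & (g * w)%g \in A]%fset A).
congr (_ + _)%N; congr (#|` _|); apply/fsetP => g; rewrite !inE.
  by case: (g \in A).
by case: (g \in A) => //=; rewrite ?andbT.
Qed.

Lemma bd1 A : bd A 1%g = 0%N.
Proof.
apply/eqP; rewrite cardfs_eq0; apply/eqP/fsetP => g; rewrite !inE mulg1.
by case: (g \in A).
Qed.

Lemma bdM A v w : (bd A (v * w)%g <= bd A v + bd A w)%N.
Proof.
pose X := [fset g in A | (g * v)%g \notin A]%fset.
pose Y := [fset g in A | (g * w)%g \notin A]%fset.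
apply: (@leq_trans #|` (X `|` [fset (g * v^-1)%g | g in Y])%fset|).
  apply: fsubset_leq_card; apply/fsubsetP => g; rewrite !inE /= => /andP[gA gvw].
  rewrite gA /=; have [gv|//] := boolP ((g * v)%g \in A); rewrite orFb.
  by apply/imfsetP; exists (g * v)%g; rewrite /= ?mulgK// !inE gv -mulgA.
rewrite (leq_trans (leq_card_fsetU _ _).1)// leq_add2l.
exact: card_fimage.
Qed.

Lemma bdV A w : bd A w^-1%g = bd A w.
Proof.
have E : #|` [fset g in A | (g * w^-1)%g \in A]%fset| = #|` [fset g in A | (g * w)%g \in A]%fset|.
  rewrite -[LHS](card_fimage_inj (f := fun g => (g * w^-1)%g)) => [|? ? _ _ /mulIg//].
  congr (#|` _|); apply/fsetP => g; apply/imfsetP/idP => [[h /= hA ->]|].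
    by move: hA; rewrite !inE mulgKV => /andP[-> ->].
  by rewrite !inE => /andP[gA gwA]; exists (g * w)%g; rewrite ?mulgK//= !inE mulgK gwA.
by apply/eqP; rewrite -(eqn_add2r #|` [fset g in A | (g * w)%g \in A]%fset|) -{1}E !bd_cardE.
Qed.

Lemma bd_word_ball A S n w : word_ball S n w -> (bd A w <= n * bdS A S)%N.
Proof.
case=> u [+ + ->]; elim: u n => [|t u IH] n /=.
  by rewrite big_nil bd1.
case: n => // n un /andP[tS uS]; rewrite big_cons mulSn.
apply: (leq_trans (bdM _ _ _)); apply: leq_add; last exact: IH.
have bdle s : s \in S -> (bd A s <= bdS A S)%N.
  by move=> sS; rewrite /bdS (big_fsetD1 s)//= leq_addr.
by case/orP: tS => [/bdle//|/bdle]; rewrite bdV.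
Qed.

Lemma word_ballS S m n : (m <= n)%N -> (word_ball S m `<=` word_ball S n)%classic.
Proof. by move=> mn w [u [um uS ->]]; exists u; split=> //; apply: leq_trans mn. Qed.

Lemma word_ballM S m n v w : word_ball S m v -> word_ball S n w ->
  word_ball S (m + n) (v * w)%g.
Proof.
case=> u [um uS ->] [u' [un uS' ->]]; exists (u ++ u').
by rewrite size_cat all_cat uS big_cat leq_add.
Qed.

Lemma word_ball_gen S t : t \in S -> word_ball S 1 t.
Proof. by move=> tS; exists [:: t]; rewrite /= tS big_seq1. Qed.

Lemma word_ball_bounded S (X : seq G) : generates S ->
  exists n, forall x, x \in X -> word_ball S n x.
Proof.
move=> gS; elim: X => [|x X [n IH]]; first by exists 0%N.
have [m xm] := gS x; exists (maxn m n) => y; rewrite inE => /orP[/eqP->|yX].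
  by apply: word_ballS xm; exact: leq_maxl.
by apply: (word_ballS (leq_maxr m n)); exact: IH.
Qed.

End Boundary.

Lemma card_fset_cond (T : choiceType) (X : {fset T}) (P : pred T) :
  #|` [fset x in X | P x]%fset| = (\sum_(x <- X) P x)%N.
Proof.
rewrite card_fset_sum1 -big_fset_condE big_mkcond /=.
by apply: eq_bigr => x _; case: (P x).
Qed.

Lemma sum_card_fibres (T I : choiceType) (L : eqType) (X : {fset T}) (Y : {fset I})
    (c : T -> L) (l : I -> L) : {in Y &, injective l} ->
  (\sum_(y <- Y) #|` [fset x in X | c x == l y]%fset| <= #|` X|)%N.
Proof.
move=> lI; under eq_bigr do rewrite card_fset_cond.
rewrite exchange_big /= card_fset_sum1; apply: leq_sum => x _.
have [[y yY xy]|ny] := pselect (exists2 y, y \in Y & c x = l y).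
  rewrite (big_fsetD1 y)//= xy eqxx big_seq big1 => [|z]; first by rewrite addn0.
  rewrite !inE => /andP[zy zY]; apply/eqP; rewrite eqb0.
  by apply: contra zy => /eqP e; apply/eqP/esym/lI.
rewrite big_seq big1// => y yY; apply/eqP; rewrite eqb0; apply/eqP => xy.
by apply: ny; exists y.
Qed.

Lemma card_le_sum_fibres (T I : choiceType) (X : {fset T}) (Y : {fset I}) (c : T -> I) :
  (forall x, x \in X -> c x \in Y) ->
  (#|` X| <= \sum_(y <- Y) #|` [fset x in X | c x == y]%fset|)%N.
Proof.
move=> cY; under eq_bigr do rewrite card_fset_cond.
rewrite exchange_big /= card_fset_sum1 big_seq [leqRHS]big_seq; apply: leq_sum => x /cY xY.
by rewrite (big_fsetD1 (c x))//= eqxx.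
Qed.

(* Each position [h] outside the frozen set [Q] that can receive [b] different labels multiplies the number of configurations by [b]; freeze [h] and iterate. *)
Lemma card_configurations (H N : choiceType) (L : eqType) (lab : N -> H -> L)
    (V : {fset N}) (b k : nat) :
  (forall v, injective (lab v)) ->
  (forall v (Q : {fset H}), v \in V -> (#|` Q| < k)%N ->
     exists h (Y : {fset H}), [/\ h \notin Q, (b <= #|` Y|)%N &
       forall y, y \in Y -> exists2 v', v' \in V &
         lab v' h = lab v y /\ forall z, z \in Q -> lab v' z = lab v z]) ->
  V != fset0 -> (b ^ k <= #|` V|)%N.
Proof.
move=> labI VP /fset0Pn[v0 v0V].
pose F (Q : {fset H}) v := [fset v' in V | all (fun z => lab v' z == lab v z) (enum_fset Q)]%fset.
(* The induction must allow arbitrary frozen labels: [F Q v] gathers the configurations that agree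
   with [v] on [Q]. *)
suff main j (Q : {fset H}) v : v \in V -> (#|` Q| + j <= k)%N -> (b ^ j <= #|` F Q v|)%N.
  apply: (leq_trans (main k fset0 v0 v0V _)); first by rewrite cardfs0.
  by apply: fsubset_leq_card; apply/fsubsetP => v; rewrite !inE => /andP[].
elim: j Q v => [|j IH] Q v vV Qk.
  rewrite expn0 cardfs_gt0; apply/fset0Pn; exists v; rewrite !inE vV /=.
  by apply/allP => z _ /=.
have [||h [Y [hQ bY YP]]] := VP v Q => //; first by lia.
have /choice[w wP] : forall y, exists v', y \in Y ->
    [/\ v' \in V, lab v' h = lab v y & forall z, z \in Q -> lab v' z = lab v z].
  move=> y; have [yY|nY] := boolP (y \in Y); last by exists v.
  by have [v' v'V [? ?]] := YP _ yY; exists v'.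
(* The new label of [h] is the one that [v] has at [y]; as [lab v] is injective, distinct [y] give
   disjoint fibres. *)
apply: (@leq_trans (\sum_(y <- Y) #|` [fset x in F Q v | lab x h == lab v y]%fset|)); last first.
  by apply: sum_card_fibres => x y _ _ /labI.
rewrite expnS; apply: (@leq_trans (\sum_(y <- Y) b ^ j)).
  by rewrite big_const_seq count_predT iter_addn_0 mulnC leq_mul2l bY orbT.
rewrite big_seq [leqRHS]big_seq; apply: leq_sum => y yY.
have [wV wh wQ] := wP _ yY.
apply: (leq_trans (IH (h |` Q)%fset (w y) wV _)).
  by rewrite cardfsU1 hQ; lia.
apply: fsubset_leq_card; apply/fsubsetP => x; rewrite !inE => /andP[-> /allP xw] /=.
apply/andP; split; last by rewrite -wh; apply: xw; rewrite !inE eqxx.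
by apply/allP => z zQ; rewrite -wQ//; apply: xw; rewrite !inE zQ orbT.
Qed.

(** * Swaps in semidirect products and the upper bound *)

Section SwapExtension.
Variables (H N : groupType) (a : autaction H N) (L : eqType).
(** In both constructions [lab n h] is a value of the permutation at [h] and [swap y] is the
    transposition of [1] and [y]. Since [a h (swap y)] transposes [h] and [h * y], multiplying [n]
    by it on the right exchanges these two labels; [swapM] is the identity (1, ky) = (1, k)(k,
    ky)(1, k). *)
Variables (lab : N -> H -> L) (swap : H -> N).
Hypothesis lab_inj : forall n, injective (lab n).
Hypothesis lab_swap : forall n h y, lab (n * a h (swap y))%g h = lab n (h * y)%g.
Hypothesis lab_swap_out : forall n h y z, z != h -> z != (h * y)%g ->
  lab (n * a h (swap y))%g z = lab n z.
Hypothesis swapK : forall y, (swap y * swap y = 1)%g.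
Hypothesis swapM : forall k y, k != 1%g -> y != 1%g -> (k * y)%g != 1%g ->
  swap (k * y)%g = (swap k * a k (swap y) * swap k)%g.

Local Notation G := (sdprod a).
Local Notation lamp y := (SDProd a (swap y) 1%g : G).
Local Notation move k := (SDProd a 1%g k : G).

Lemma lampE (u : G) y : (u * lamp y)%g = SDProd a (sdl u * a (sdr u) (swap y))%g (sdr u) :> G.
Proof. by rewrite -[RHS]/(SDProd _ _ _); congr SDProd; rewrite /= mulg1. Qed.

Lemma lampK y : (lamp y * lamp y = 1)%g.
Proof. by rewrite lampE /= lact1 swapK. Qed.

(** The lamp of the shorter element [y] occurs only once on the right, so the cost grows by a
    constant per letter: linearly, not exponentially, in the word length. *)
Lemma lampM k y : k != 1%g -> y != 1%g -> (k * y)%g != 1%g ->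
  lamp (k * y)%g = (lamp k * (move k * (lamp y * ((move k)^-1 * lamp k))))%g.
Proof.
move=> k1 y1 ky1; rewrite swapM//.
rewrite -[RHS]/(sd_mul (lamp k) (sd_mul (move k) (sd_mul (lamp y) (sd_mul (sd_inv (move k)) (lamp k))))).
rewrite /sd_mul /sd_inv /=.
by rewrite invg1 !(lact1, aactr1, mul1g, mulg1, mulgV, lactVK) aactMr lactVK mulgA.
Qed.

Lemma lamp_cost (SP : {fset G}) (SH : {fset H}) : generates SP ->
  exists c : nat, forall (A : {fset G}),
    (forall k, k \in SH -> (bd A (move k) <= c * bdS A SP)%N) /\
    (forall R y, y != 1%g -> word_ball SH R y ->
       (bd A (lamp y) <= c * R * bdS A SP)%N).
Proof.
move=> gSP; pose T := enum_fset SH ++ [seq t^-1%g | t <- enum_fset SH].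
have [l lP] := word_ball_bounded ([seq (move k : G) | k <- T] ++ [seq (lamp k : G) | k <- T]) gSP.
have moveP A k : k \in T -> (bd A (move k) <= l * bdS A SP)%N.
  move=> kT; apply: bd_word_ball; apply: lP.
  by rewrite mem_cat; apply/orP; left; exact: (map_f (fun k => (move k : G)) kT).
have lampP A k : k \in T -> (bd A (lamp k) <= l * bdS A SP)%N.
  move=> kT; apply: bd_word_ball; apply: lP.
  by rewrite mem_cat; apply/orP; right; exact: (map_f (fun k => (lamp k : G)) kT).
(* Each letter contributes two lamps and two moves, each of cost [l]. *)
exists (4 * l)%N => A; split=> [k kSH|R y y1 [w [wR + yE]]].
  apply: (leq_trans (moveP A k _)); first by rewrite mem_cat kSH.
  by rewrite leq_mul2r; apply/orP; right; lia.
move=> wS; have {wS wR} : (4 * l * size w * bdS A SP <= 4 * l * R * bdS A SP)%N /\ all (mem T) w.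
  split; first by rewrite leq_mul2r leq_mul2l wR !orbT.
  apply/allP => t /(allP wS) /orP[tS|tS] /=; rewrite mem_cat; first by rewrite tS.
  by apply/orP; right; rewrite -[t]invgK; apply: map_f.
case=> + wT; apply: leq_trans; rewrite {}yE in y1 *.
elim: w y1 wT => [|k w IH]; first by rewrite big_nil eqxx.
rewrite big_cons => ky1 /= /andP[kT wT].
have [k1|k1] := eqVneq k 1%g.
  rewrite k1 mul1g; apply: (leq_trans (IH _ wT)); first by move: ky1; rewrite k1 mul1g.
  by rewrite leq_mul2r leq_mul2l leqnSn !orbT.
have [w1|w1] := eqVneq (\prod_(t <- w) t)%g 1%g.
  rewrite w1 mulg1; apply: (leq_trans (lampP A k kT)).
  by rewrite leq_mul2r; apply/orP; right; nia.
rewrite lampM//.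
have := IH w1 wT; have := moveP A k kT; have := lampP A k kT.
set d := bdS A SP; move=> b1 b2 b3.
apply: (leq_trans (bdM _ _ _)).
apply: (leq_trans (leq_add (leqnn _) (bdM _ _ _))).
apply: (leq_trans (leq_add (leqnn _) (leq_add (leqnn _) (bdM _ _ _)))).
apply: (leq_trans (leq_add (leqnn _) (leq_add (leqnn _) (leq_add (leqnn _) (bdM _ _ _))))).
rewrite bdV /=.
have -> : (4 * l * (size w).+1 * d = 4 * (l * d) + 4 * l * size w * d)%N by ring.
apply: (leq_trans (leq_add b1 (leq_add b2 (leq_add b3 (leq_add b2 b1))))).
by move: (l * d)%N (4 * l * size w * d)%N => *; lia.
Qed.

Definition over (A : {fset G}) (V : {fset N}) : {fset G} :=
  [fset u in A | sdl u \in V]%fset.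

Definition slice (A : {fset G}) (n : N) : {fset G} :=
  [fset u in A | sdl u == n]%fset.

(** Once [n] is removed, the points of its slice that left [over A V] stop counting as boundary, and
    the new boundary points are those sent into that slice. As [lamp y] is an involution, these are
    at most as many as the points of the slice sent into [over A V]. *)
Lemma bd_over_rem (A : {fset G}) (V : {fset N}) n y : n \in V ->
  (bd (over A (V `\ n)%fset) (lamp y) +
     #|` [fset u in slice A n | (u * lamp y)%g \notin over A V]%fset| <=
   bd (over A V) (lamp y) +
     #|` [fset u in slice A n | (u * lamp y)%g \in over A V]%fset|)%N.
Proof.
move=> nV; rewrite /bd.
set W := over A (V `\ n)%fset.
pose X := [fset u in W | (u * lamp y)%g \notin over A V]%fset.
pose Z := [fset u in W | (u * lamp y)%g \in slice A n]%fset.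
set O := [fset u in slice A n | (u * lamp y)%g \notin over A V]%fset.
set T := [fset u in slice A n | (u * lamp y)%g \in over A V]%fset.
apply: (@leq_trans (#|` X| + #|` Z| + #|` O|)).
  rewrite leq_add2r (leq_trans _ (leq_card_fsetU X Z).1)//.
  apply: fsubset_leq_card; apply/fsubsetP => u; rewrite !inE /=.
  move=> /andP[/andP[-> /andP[-> ->]]] /=.
  by case: (_ \in _); case: (_ == n); case: (_ \in V).
rewrite addnAC leq_add//.
  have /eqP <- : #|` (X `|` O)%fset| == (#|` X| + #|` O|)%N.
    rewrite (leq_card_fsetU X O).2 -fsetI_eq0; apply/eqP/fsetP => u; rewrite !inE.
    by case: (sdl u =P n); rewrite ?(andbF, andFb).
  apply: fsubset_leq_card; apply/fsubsetP => u; rewrite !inE.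
  move=> /orP[/andP[/andP[-> /andP[_ ->]] ->]//|].
  by move=> /andP[/andP[-> /eqP ->]]; rewrite nV => ->.
rewrite -(card_fimage_inj (A := Z) (f := fun u => (u * lamp y)%g)) => [|? ? _ _ /mulIg//].
apply: fsubset_leq_card; apply/fsubsetP => u /imfsetP[/= {}u + ->].
rewrite !inE -mulgA lampK mulg1 => /andP[/andP[-> /andP[_ ->]]] /andP[-> ->].
by [].
Qed.

(* A configuration [n] whose slice is mostly sent outside of [over A V] by the lamps can be discarded: the invariant [2 D(V) < |B| |over A V|] survives, [D] being the total boundary along the lamps, and [V] stays nonempty. *)
Lemma peel_slices (A : {fset G}) (B : {fset H}) (V0 : {fset N}) :
  (2 * (\sum_(y <- B) bd (over A V0) (lamp y)) < #|` B| * #|` over A V0|)%N ->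
  exists2 V : {fset N}, (V `<=` V0)%fset /\ V != fset0 & forall n, n \in V ->
    (#|` B| * #|` slice A n| <=
     4 * \sum_(y <- B) #|` [fset u in slice A n | (u * lamp y)%g \in over A V]%fset|)%N.
Proof.
have [c] := ubnP #|` V0|; elim: c V0 => // c IH V0 V0c inv.
have [Vok|] := pselect (forall n, n \in V0 ->
    (#|` B| * #|` slice A n| <=
     4 * \sum_(y <- B) #|` [fset u in slice A n | (u * lamp y)%g \in over A V0]%fset|)%N).
  exists V0 => //; split=> //; apply/eqP => V00; move: inv.
  suff -> : over A V0 = fset0 by rewrite cardfs0 muln0.
  by apply/fsetP => u; rewrite !inE V00 inE andbF.
move=> /existsNP[n /not_implyP[nV0 /negP]]; rewrite -ltnNge => nbad.
have [||V [VV0 V1] VP] := IH (V0 `\ n)%fset; last first.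
- by exists V => //; split=> //; apply: fsubset_trans VV0 _; exact: fsubD1set.
- have sizeE : (#|` over A V0| = #|` over A (V0 `\ n)%fset| + #|` slice A n|)%N.
    rewrite -(cardfsID [fset u in A | sdl u == n]%fset (over A V0)) addnC.
    congr (_ + _)%N; congr (#|` _|); apply/fsetP => u; rewrite !inE.
      by case: (u \in A) => //=; case: (sdl u == n); rewrite ?andbF.
    by case: (u \in A) => //=; case: (sdl u =P n) => [->|_]; rewrite ?nV0 ?andbF.
  have outE : (\sum_(y <- B) #|` [fset u in slice A n | (u * lamp y)%g \notin over A V0]%fset|
      + \sum_(y <- B) #|` [fset u in slice A n | (u * lamp y)%g \in over A V0]%fset|
      = #|` B| * #|` slice A n|)%N.
    rewrite -big_split /= -sum1_size big_distrl /=; apply: eq_bigr => y _.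
    rewrite mul1n addnC -(cardfsID [fset u | u in slice A n & (u * lamp y)%g \in over A V0]%fset (slice A n)).
    by congr (_ + _)%N; congr (#|` _|); apply/fsetP => u; rewrite !inE; case: (u \in A) => //=;
      case: eqP => //= _; rewrite ?andbT.
  (* Let [s] count all pairs of a point of the slice and an element of [B], and [t] those that stay
     in [over A V0]; badness means [4 t < s]. The total boundary drops by at least
     [(s - t) - t > s / 2], so its double drops by more than [s], the loss on the right of the
     invariant. *)
  have : (\sum_(y <- B) bd (over A (V0 `\ n)%fset) (lamp y) +
     \sum_(y <- B) #|` [fset u in slice A n | (u * lamp y)%g \notin over A V0]%fset| <=
    \sum_(y <- B) bd (over A V0) (lamp y) +
     \sum_(y <- B) #|` [fset u in slice A n | (u * lamp y)%g \in over A V0]%fset|)%N.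
    by rewrite -!big_split /=; apply: leq_sum => y _; exact: bd_over_rem.
  move: inv nbad outE; rewrite sizeE mulnDr.
  by move: (#|` B| * _)%N (#|` B| * _)%N (\sum_(_ <- _) _)%N (\sum_(_ <- _) _)%N
    (\sum_(_ <- _) _)%N (\sum_(_ <- _) _)%N => *; lia.
- by move: V0c; rewrite (cardfsD1 n V0) nV0; lia.
Qed.

(** After [peel_slices], at least a quarter of the pairs of a point of a slice and an element of [B]
    stay in [over A V]. Fewer than an eighth touch fewer than [k] frozen positions, a slice having
    more than [16 * k] points. On average a point then keeps an eighth of [B], which is at least [b]
    labels. *)
Lemma card_exp_ge (A : {fset G}) (B : {fset H}) (b k : nat) :
  A != fset0 -> (0 < b)%N -> (8 * b <= #|` B|)%N ->
  (16 * #|` [fset u in A | (#|` slice A (sdl u)| <= 16 * k)%N]%fset| <= #|` A|)%N ->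
  (16 * (\sum_(y <- B) bd A (lamp y)) <= #|` B| * #|` A|)%N ->
  (b ^ k <= #|` A|)%N.
Proof.
move=> A0 b0 bB smallA bdA.
have Bpos : (0 < #|` B|)%N by rewrite (leq_trans _ bB)// muln_gt0.
pose S := [fset u in A | (#|` slice A (sdl u)| <= 16 * k)%N]%fset.
pose V0 := [fset sdl u | u in A & (16 * k < #|` slice A (sdl u)|)%N]%fset.
have overE : over A V0 = [fset u in A | (16 * k < #|` slice A (sdl u)|)%N]%fset.
  apply/fsetP => u; rewrite !inE; case uA : (u \in A) => //=.
  apply/imfsetP/idP => [[v /= + ->]|uk]; first by rewrite !inE => /andP[].
  by exists u; rewrite //= !inE uA.
have cardE : (#|` over A V0| + #|` S| = #|` A|)%N.
  rewrite -(cardfsID (over A V0) A); congr (_ + _)%N; congr (#|` _|);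
  by apply/fsetP => u; rewrite overE !inE; case: (u \in A) => //=; rewrite -leqNgt ?andbT.
have : (2 * (\sum_(y <- B) bd (over A V0) (lamp y)) < #|` B| * #|` over A V0|)%N.
  (* A point that leaves [over A V0] leaves [A] or lands in a thin slice; by injectivity of
     translations the second case occurs at most once per element of [S] and per lamp. *)
  have : (\sum_(y <- B) bd (over A V0) (lamp y) <= \sum_(y <- B) bd A (lamp y) + #|` B| * #|` S|)%N.
    rewrite -[#|` B|]sum1_size big_distrl -big_split /=; apply: leq_sum => y _.
    pose X := [fset u in A | (u * lamp y)%g \notin A]%fset.
    pose Y := [fset u in A | (u * lamp y)%g \in S]%fset.
    apply: (@leq_trans (#|` X| + #|` Y|)).
      rewrite (leq_trans _ (leq_card_fsetU X Y).1)//.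
      apply: fsubset_leq_card; apply/fsubsetP => u; rewrite overE !inE.
      move=> /andP[/andP[-> _]] /=; rewrite leqNgt.
      by case: (_ \in _); case: ltnP.
    rewrite leq_add2l mul1n.
    rewrite -(card_fimage_inj (A := Y) (f := fun u => (u * lamp y)%g)) => [|? ? _ _ /mulIg//].
    apply: fsubset_leq_card; apply/fsubsetP => u /imfsetP[/= {}u + ->].
    by rewrite inE => /andP[_].
  have Apos : (0 < #|` A|)%N by rewrite cardfs_gt0.
  have P1 : (0 < #|` B| * #|` A|)%N by rewrite muln_gt0 Bpos.
  have P2 : (16 * (#|` B| * #|` S|) <= #|` B| * #|` A|)%N by rewrite mulnCA leq_mul2l smallA orbT.
  have P3 : (#|` B| * #|` over A V0| + #|` B| * #|` S| = #|` B| * #|` A|)%N by rewrite -mulnDr cardE.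
  move: P1 P2 P3 bdA; move: (#|` B| * _)%N (#|` B| * _)%N (#|` B| * _)%N => cA cS cV.
  by move: (\sum_(_ <- _) _)%N (\sum_(_ <- _) _)%N => s1 s2 *; lia.
move=> /peel_slices[V [VV0 V1] VP].
have VA : (#|` V| <= #|` A|)%N.
  apply: leq_trans (fsubset_leq_card VV0) _.
  apply: leq_trans (card_fimage (fun u : G => sdl u) A).
  apply: fsubset_leq_card; apply/fsubsetP => n /imfsetP[u /=]; rewrite !inE => /andP[uA _] ->.
  exact: (in_imfset _ (fun u : G => sdl u)).
apply: leq_trans VA; apply: card_configurations lab_inj _ V1 => n Q nV Qk.
have nbig : (16 * k < #|` slice A n|)%N.
  have /imfsetP[u /= + ->] := fsubsetP VV0 _ nV.
  by rewrite inE => /andP[].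
have sdrI : {in slice A n &, injective (fun u : G => sdr u)}.
  by move=> [n1 h1] [n2 h2]; rewrite !inE /= => /andP[_ /eqP ->] /andP[_ /eqP ->] ->.
(* Neither of the two exchanged positions may be frozen, otherwise the labels on [Q] would
   change. *)
pose good (u : G) y := [&& sdr u \notin Q, (sdr u * y)%g \notin Q & (u * lamp y)%g \in over A V].
have goodP y : (#|` [fset u in slice A n | (u * lamp y)%g \in over A V]%fset| <=
    #|` [fset u in slice A n | good u y]%fset| + 2 * #|` Q|)%N.
  pose X := [fset u in slice A n | sdr u \in Q]%fset.
  pose Y := [fset u in slice A n | (sdr u * y)%g \in Q]%fset.
  have XQ : (#|` X| <= #|` Q|)%N.
    rewrite -(card_fimage_inj (A := X) (f := fun u => sdr u)).
      apply: fsubset_leq_card; apply/fsubsetP => h /imfsetP[u /= + ->].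
      by rewrite inE => /andP[].
    by apply: sub_in2 sdrI => u; rewrite !inE => /andP[].
  have YQ : (#|` Y| <= #|` Q|)%N.
    rewrite -(card_fimage_inj (A := Y) (f := fun u => (sdr u * y)%g)).
      apply: fsubset_leq_card; apply/fsubsetP => h /imfsetP[u /= + ->].
      by rewrite inE => /andP[].
    have YA : {subset Y <= slice A n} by move=> u; rewrite !inE => /andP[].
    by move=> u v /YA uA /YA vA /mulIg; exact: sdrI.
  apply: (@leq_trans (#|` [fset u in slice A n | good u y]%fset| + (#|` X| + #|` Y|))); last by lia.
  rewrite (leq_trans _ (leq_add (leqnn _) (leq_card_fsetU X Y).1))//.
  rewrite (leq_trans _ (leq_card_fsetU _ _).1)//.
  apply: fsubset_leq_card; apply/fsubsetP => u; rewrite /X /Y /good.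
  move: (over A V) => W; rewrite !inE => /andP[-> ->] /=; rewrite andbT.
  by case: (_ \in Q); case: (_ \in Q).
have [u uA uP] : exists2 u, u \in slice A n & (b <= #|` [fset y in B | good u y]%fset|)%N.
  apply: contrapT => no.
  have : (\sum_(y <- B) #|` [fset u in slice A n | good u y]%fset| <= #|` slice A n| * b.-1)%N.
    under eq_bigr do rewrite card_fset_cond.
    rewrite exchange_big /= -sum1_size big_distrl /= big_seq [leqRHS]big_seq.
    apply: leq_sum => u uA; rewrite mul1n -card_fset_cond.
    by have [//|?] := leqP #|` [fset y in B | good u y]%fset| b.-1; case: no; exists u => //; lia.
  have := VP _ nV.
  have : (\sum_(y <- B) #|` [fset u in slice A n | (u * lamp y)%g \in over A V]%fset| <=
      \sum_(y <- B) #|` [fset u in slice A n | good u y]%fset| + #|` B| * (2 * #|` Q|))%N.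
    by rewrite -[#|` B|]sum1_size big_distrl -big_split /=; apply: leq_sum => y _; rewrite mul1n.
  have P1 : (16 * (#|` B| * #|` Q|) < #|` B| * #|` slice A n|)%N.
    by rewrite mulnCA ltn_mul2l Bpos; lia.
  have P2 : (8 * (#|` slice A n| * b.-1) + 8 * #|` slice A n| <= #|` B| * #|` slice A n|)%N.
    by rewrite -mulnDr -mulnSr prednK// mulnCA [leqRHS]mulnC leq_mul2l bB orbT.
  move: nbig P1 P2; rewrite [(#|` B| * (2 * _))%N]mulnCA.
  move: (#|` slice A n| * _)%N => t; move: (#|` B| * _)%N (#|` B| * _)%N => bQ bs.
  move: (#|` slice A n|) => sl.
  by move: (\sum_(_ <- _) _)%N (\sum_(_ <- _) _)%N => s1 s2 *; lia.
exists (sdr u), [fset (sdr u * y)%g | y in [fset y in B | good u y]]%fset; split.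
- have : (0 < #|` [fset y in B | good u y]%fset|)%N by lia.
  by rewrite cardfs_gt0 => /fset0Pn[y]; rewrite !inE => /andP[_ /and3P[]].
- by rewrite card_fimage_inj// => ? ? _ _ /mulgI.
move=> hy /imfsetP[y /=]; rewrite !inE => /andP[yB /and3P[hQ hyQ]].
rewrite !inE lampE /= => /andP[_ vV] ->.
have un : sdl u = n by move: uA; rewrite inE => /andP[_ /eqP].
rewrite un in vV; exists (n * a (sdr u) (swap y))%g => //; split; first exact: lab_swap.
move=> z zQ; apply: lab_swap_out.
  by apply: contraNneq hQ => <-.
by apply: contraNneq hyQ => <-.
Qed.

(** A move keeps the configuration, so the boundaries of distinct slices along it are disjoint parts
    of the boundary of [A]; slices of size at most [16 * k <= m] obey the isoperimetric inequality
    of [H]. *)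
Lemma card_thin_slices (R : realType) (SH : {fset H}) (m r : R) (A : {fset G}) (k c : nat) :
  0 <= r -> isoper SH m r -> (16 * k)%:R <= m ->
  (forall t, t \in SH -> (bd A (move t) <= c)%N) ->
  #|` [fset u in A | (#|` slice A (sdl u)| <= 16 * k)%N]%fset|%:R <= 2 * r * (#|` SH| * c)%:R.
Proof.
move=> r0 isoH km bdA; set S := [fset u in A | _]%fset.
pose Y := [fset sdl u | u in S]%fset.
have SY u : u \in S -> sdl u \in Y by move=> uS; apply/imfsetP; exists u.
apply: (@le_trans _ _ (\sum_(n <- Y) #|` slice A n|)%:R).
  rewrite ler_nat; apply: leq_trans (card_le_sum_fibres SY) _.
  apply: leq_sum => n _; apply: fsubset_leq_card; apply/fsubsetP => u.
  by rewrite !inE => /andP[/andP[-> _] ->].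
pose pos n := [fset sdr u | u in slice A n]%fset.
have posI n : {in slice A n &, injective (fun u : G => sdr u)}.
  by move=> [n1 h1] [n2 h2]; rewrite !inE /= => /andP[_ /eqP ->] /andP[_ /eqP ->] ->.
apply: (@le_trans _ _ (2 * r * (\sum_(n <- Y) bdS (pos n) SH)%:R)).
  rewrite !natr_sum mulr_sumr big_seq [leRHS]big_seq; apply: ler_sum => n /imfsetP[u /= + ->].
  rewrite inE => /andP[_ uk]; rewrite -(card_fimage_inj (@posI _)); apply: isoH.
  by rewrite (card_fimage_inj (@posI _)) (le_trans _ km)// ler_nat.
rewrite ler_wpM2l ?mulr_ge0// ler_nat /bdS exchange_big /= -sum1_size big_distrl /=.
rewrite big_seq [leqRHS]big_seq; apply: leq_sum => t tS; rewrite mul1n (leq_trans _ (bdA t tS))//.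
rewrite (leq_trans _ (sum_card_fibres [fset u in A | (u * move t)%g \notin A]%fset (fun u => sdl u) (Y := Y) (l := id) _))//.
apply: leq_sum => n _; rewrite /bd.
set X := [fset h in _ | _]%fset; pose Z := [fset u in slice A n | (u * move t)%g \notin A]%fset.
apply: (@leq_trans #|` [fset sdr u | u in Z]%fset|).
  apply: fsubset_leq_card; apply/fsubsetP => h; rewrite inE => /andP[/imfsetP[u /= uA ->] ut].
  apply/imfsetP; exists u => //; move: uA; rewrite !inE => /andP[uA un].
  rewrite uA un; apply: contra ut => utA; apply/imfsetP; exists (u * move t)%g => //.
  by rewrite !inE utA /= aactr1 mulg1.
apply: leq_trans (card_fimage _ _) _; apply: fsubset_leq_card; apply/fsubsetP => u.
by rewrite !inE => /andP[/andP[-> ->] ->].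
Qed.

(** A set violating the inequality has so little boundary that [card_exp_ge] gives it at least
    [b ^ k > x] points. The condition [n%:R <= r] lets the same [r] control the cost of the lamps
    and the thin slices. *)
Lemma isoper_swap_extension (R : realType) (SP : {fset G}) (SH : {fset H}) : generates SP ->
  exists2 C : R, 0 < C & forall (m r x : R) (n b k : nat) (B : {fset H}),
    n%:R <= r -> isoper SH m r -> (16 * k)%:R <= m ->
    (0 < b)%N -> (8 * b <= #|` B|)%N ->
    (forall y, y \in B -> y != 1%g /\ word_ball SH n y) ->
    x < (b ^ k)%:R -> isoper SP x (C * r).
Proof.
move=> gSP; have [c cP] := lamp_cost SH gSP.
(* The 16 is that of [card_exp_ge], [c] is the cost of moves and lamps, and the size of [SH] comes
   from summing over the generators; successors keep the constant positive. *)
exists (16 * (c.+1 * #|` SH|.+1)%:R); first by rewrite mulr_gt0// ltr0n.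
move=> m r x n b k B nr isoH km b0 bB BP xb A Ax.
have r0 : 0 <= r by apply: le_trans nr.
have [moveP lampP] := cP A.
rewrite leNgt; apply/negP => Alarge.
have A0 : A != fset0.
  rewrite -cardfs_gt0 -(ltr_nat R) (le_lt_trans _ Alarge)//.
  by rewrite !mulr_ge0.
set d := bdS A SP in Alarge moveP lampP.
suff : (b ^ k <= #|` A|)%N by rewrite leqNgt -(ltr_nat R) (le_lt_trans Ax xb).
have crd : 0 <= r * d%:R by rewrite mulr_ge0.
apply: (card_exp_ge (B := B)) => //; rewrite -(ler_nat R) !natrM.
  have := card_thin_slices r0 isoH km moveP.
  set s := #|` _|%:R; rewrite -/s => sle.
  apply: le_trans _ (ltW Alarge); apply: (le_trans (ler_wpM2l _ sle)) => //.
  rewrite !natrM; set p := #|` SH|%:R; have -> : c.+1%:R = c%:R + 1 :> R by rewrite natr1.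
  have -> : #|` SH|.+1%:R = p + 1 :> R by rewrite natr1.
  rewrite -subr_ge0; set e := _ - _.
  have -> : e = 32 * (r * d%:R) * (c%:R + p + 1) by rewrite /e; ring.
  by rewrite !mulr_ge0// !addr_ge0.
have le1 : (\sum_(y <- B) bd A (lamp y) <= #|` B| * (c * n * d))%N.
  rewrite -sum1_size big_distrl /= big_seq [leqRHS]big_seq; apply: leq_sum => y yB.
  by rewrite mul1n; have [y1 yn] := BP _ yB; exact: lampP.
apply: (@le_trans _ _ (16%:R * (#|` B| * (c * n * d))%:R)); first by rewrite ler_wpM2l// ler_nat.
rewrite natrM mulrCA ler_wpM2l//; apply: le_trans _ (ltW Alarge).
rewrite !natrM.
have -> : c.+1%:R = c%:R + 1 :> R by rewrite natr1.
have -> : #|` SH|.+1%:R = #|` SH|%:R + 1 :> R by rewrite natr1.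
have : c%:R * n%:R * d%:R <= c%:R * (r * d%:R) :> R.
  by rewrite mulrA ler_wpM2r// ler_wpM2l.
have : 0 <= c%:R * (r * d%:R) by rewrite mulr_ge0.
have : 0 <= #|` SH|%:R * (r * d%:R) by rewrite mulr_ge0.
have : 0 <= c%:R * #|` SH|%:R * (r * d%:R) by rewrite !mulr_ge0.
have -> : 2 * (16 * ((c%:R + 1) * (#|` SH|%:R + 1)) * r) * d%:R =
  32 * (c%:R * #|` SH|%:R * (r * d%:R) + c%:R * (r * d%:R) + #|` SH|%:R * (r * d%:R) + r * d%:R) by ring.
lra.
Qed.

End SwapExtension.

(** * Masses, energies and profiles *)

Section FiniteSums.
Variables (R : realType) (G : groupType).
Implicit Types (F E : G -> R) (A : {fset G}).

Lemma finite_suppP F : finite_set (supp F) <-> exists A, forall g, g \notin A -> F g = 0.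
Proof.
split=> [/finite_fsetP[A sA]|[A FA]].
  exists A => g gA; apply: contrapT => /eqP Fg.
  have : supp F g by [].
  by rewrite sA /= (negbTE gA).
apply: (sub_finite_set _ (finite_fset A)) => g /= Fg.
by apply: contraNT Fg => /FA ->.
Qed.

Lemma fsum_le F E : (forall g, 0 <= F g <= E g) -> finite_set (supp E) ->
  \sum_(g \in [set: G]) F g <= \sum_(g \in [set: G]) E g.
Proof.
move=> FE /finite_suppP[A EA].
have FA g : g \notin A -> F g = 0.
  by move=> /EA e; have := FE g; rewrite e -eq_le => /eqP.
by rewrite !(fsbigTE A)//; apply: ler_sum => g _; case/andP: (FE g).
Qed.

Lemma fsum_ge0 F : (forall g, 0 <= F g) -> 0 <= \sum_(g \in [set: G]) F g.
Proof.
move=> F0; have [|nf] := pselect (finite_set (supp F)).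
  by move=> /finite_suppP[A FA]; rewrite (fsbigTE A)//; apply: sumr_ge0.
(* With infinite support the finitary sum has its default value 0. *)
by rewrite fsbig_dflt//; apply: contra_not nf; rewrite setTI; apply: sub_finite_set => g /= /eqP.
Qed.

Lemma fsumD F E : finite_set (supp F) -> finite_set (supp E) ->
  \sum_(g \in [set: G]) (F g + E g) =
  \sum_(g \in [set: G]) F g + \sum_(g \in [set: G]) E g.
Proof.
move=> /finite_suppP[A FA] /finite_suppP[B EB].
rewrite !(fsbigTE (A `|` B)%fset) ?big_split// => g; rewrite !inE negb_or => /andP[/FA a /EB b]//.
by rewrite a b addr0.
Qed.

Lemma fsumZ (c : R) F : finite_set (supp F) ->
  \sum_(g \in [set: G]) (c * F g) = c * \sum_(g \in [set: G]) F g.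
Proof.
move=> /finite_suppP[A FA].
by rewrite !(fsbigTE A) ?mulr_sumr// => g /FA ->; rewrite mulr0.
Qed.

Lemma fsum_exchange (T : eqType) (s : seq T) (F : T -> G -> R) :
  (forall t, finite_set (supp (F t))) ->
  \sum_(g \in [set: G]) \sum_(t <- s) F t g = \sum_(t <- s) \sum_(g \in [set: G]) F t g.
Proof.
move=> fF; elim: s => [|t s IH].
  by rewrite big_nil fsbig1// => g _; rewrite big_nil.
rewrite big_cons -IH -fsumD//.
  by apply: eq_fsbigr => g _; rewrite big_cons.
have /choice[A AP] : forall t, exists A : {fset G}, forall g, g \notin A -> F t g = 0.
  by move=> u; apply/finite_suppP.
apply/finite_suppP; elim: s {IH} => [|u s [B BP]]; first by exists fset0 => g _; rewrite big_nil.
exists (A u `|` B)%fset => g; rewrite !inE negb_or => /andP[/AP a /BP b].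
by rewrite big_cons a b addr0.
Qed.

Lemma fsum_translate F w : \sum_(g \in [set: G]) F (g * w)%g = \sum_(g \in [set: G]) F g.
Proof.
rewrite [RHS](reindex_fsbigT (fun g => (g * w)%g))//.
by exists (fun g => (g * w^-1)%g) => g; rewrite ?mulgK ?mulgKV.
Qed.

End FiniteSums.

Section Energy.
Variables (R : realType) (G : groupType) (p : R).
Hypothesis p1 : 1 <= p.
Implicit Types (f : G -> R) (S A : {fset G}) (v w t : G).

Let p0 : 0 < p. Proof. exact: lt_le_trans p1. Qed.

(** Energies and masses are p-th powers, hence additive over generators and fibres; roots return
    only when quotients are formed. *)
Definition energy w f : R := \sum_(g \in [set: G]) `|f g - f (g * w)%g| `^ p.

Definition energies S f : R := \sum_(t <- S) energy t f.

Definition mass f : R := \sum_(g \in [set: G]) `|f g| `^ p.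

Lemma energy_fin f w : finite_set (supp f) ->
  finite_set (supp (fun g => `|f g - f (g * w)%g| `^ p)).
Proof.
move=> /finite_suppP[A fA]; apply/finite_suppP.
exists (A `|` [fset (g * w^-1)%g | g in A])%fset => g.
rewrite !inE negb_or => /andP[/fA ->] gw; rewrite fA ?subrr ?normr0 ?powR0 ?gt_eqF//.
by apply: contra gw => gw; apply/imfsetP; exists (g * w)%g; rewrite //= mulgK.
Qed.

Lemma energy_ge0 w f : 0 <= energy w f.
Proof. by apply: fsum_ge0 => g; exact: powR_ge0. Qed.

Lemma energies_ge0 S f : 0 <= energies S f.
Proof. by apply: sumr_ge0 => t _; exact: energy_ge0. Qed.

Lemma mass_ge0 f : 0 <= mass f.
Proof. by apply: fsum_ge0 => g; exact: powR_ge0. Qed.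

Lemma mass_gt0 f : finite_set (supp f) -> (exists g, f g != 0) -> 0 < mass f.
Proof.
move=> ff [g fg]; have [A fA] := (finite_suppP f).1 ff.
rewrite /mass (fsbigTE A) => [|h /fA ->]; last by rewrite normr0 powR0// gt_eqF.
have gA : g \in A by apply: contraNT fg => /fA ->.
rewrite (big_fsetD1 g)//= ltr_wpDr ?powR_gt0 ?normr_gt0//.
by apply: sumr_ge0 => h _; exact: powR_ge0.
Qed.

Lemma norm_pE f : norm_p p f = mass f `^ p^-1.
Proof. by []. Qed.

Lemma grad_pE S f : finite_set (supp f) -> grad_p p S f = energies S f `^ p^-1.
Proof.
by move=> ff; rewrite /grad_p fsum_exchange// => t; exact: energy_fin.
Qed.

Lemma ratio_le (S : {fset G}) f (r : R) : finite_set (supp f) -> (exists g, f g != 0) -> 0 <= r ->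
  mass f <= r `^ p * energies S f -> ((norm_p p f)%:E / (grad_p p S f)%:E <= r%:E)%E.
Proof.
move=> ff f0 r0 le; rewrite norm_pE grad_pE//.
have m0 := mass_gt0 ff f0; have e0 : 0 < energies S f.
  rewrite lt_neqAle energies_ge0 andbT eq_sym; apply: contraTneq le => ->.
  by rewrite mulr0 -ltNge.
rewrite inver gt_eqF ?powR_gt0// -EFinM lee_fin ler_pdivrMr ?powR_gt0//.
rewrite -[r]powRr1// -[X in r `^ X](@mulfV _ p) ?gt_eqF// powRrM -powRM ?powR_ge0//; last exact: ltW.
by rewrite ge0_ler_powR ?invr_ge0// ?nnegrE ?mulr_ge0 ?powR_ge0// ltW.
Qed.

Lemma ratio_ge (S : {fset G}) f (r : R) : finite_set (supp f) -> (exists g, f g != 0) -> 0 <= r ->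
  r `^ p * energies S f <= mass f -> (r%:E <= (norm_p p f)%:E / (grad_p p S f)%:E)%E.
Proof.
move=> ff f0 r0 le; rewrite norm_pE grad_pE//.
(* With zero energy the quotient is [+oo]. *)
have m0 := mass_gt0 ff f0; have := energies_ge0 S f; rewrite le_eqVlt => /orP[/eqP <-|e0].
  rewrite powR0 ?invr_neq0 ?gt_eqF// inver eqxx.
  by rewrite gt0_muley ?leey// lte_fin powR_gt0.
rewrite inver gt_eqF ?powR_gt0// -EFinM lee_fin ler_pdivlMr ?powR_gt0//.
rewrite -[r]powRr1// -[X in r `^ X](@mulfV _ p) ?gt_eqF// powRrM -powRM ?powR_ge0//; last exact: ltW.
by rewrite ge0_ler_powR ?invr_ge0// ?nnegrE ?mulr_ge0 ?powR_ge0// ltW.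
Qed.

Lemma ratio_ge0 S f : (0 <= (norm_p p f)%:E / (grad_p p S f)%:E)%E.
Proof. by rewrite mule_ge0// ?inve_ge0 lee_fin powR_ge0. Qed.

Lemma profile_le_fin S (x r : R) : 0 <= r ->
  (forall f, admissible x f -> mass f <= r `^ p * energies S f) ->
  (profile p S x <= r%:E)%E.
Proof.
move=> r0 le; apply: ge_ereal_sup => _ [f fx <-].
by have [_ f0 ff _] := fx; apply: ratio_le => //; exact: le.
Qed.

Lemma profile_ge_fin S (x r : R) f : 0 <= r -> admissible x f ->
  r `^ p * energies S f <= mass f -> (r%:E <= profile p S x)%E.
Proof.
move=> r0 fx le; have [_ f0 ff _] := fx.
by apply: (le_trans (ratio_ge ff f0 r0 le)); apply: ereal_sup_ubound; exists f.
Qed.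

Lemma profile_mono S (x y : R) : x <= y -> (profile p S x <= profile p S y)%E.
Proof.
move=> xy; apply: ereal_sup_le => _ [f [f0 fn ff fx] <-].
by exists f => //; split => //; apply: le_trans xy.
Qed.

Lemma energyM v w f : finite_set (supp f) ->
  energy (v * w) f <= 2 `^ p * (energy v f + energy w f).
Proof.
move=> ff; have fw : finite_set (supp (fun g => `|f (g * v)%g - f (g * v * w)%g| `^ p)).
  have [A fA] := (finite_suppP _).1 (energy_fin w ff); apply/finite_suppP.
  exists [fset (g * v^-1)%g | g in A]%fset => g gA; apply: (fA (g * v)%g).
  by apply: contra gA => gA; apply/imfsetP; exists (g * v)%g; rewrite //= mulgK.
have <- : \sum_(g \in [set: G]) `|f (g * v)%g - f (g * v * w)%g| `^ p = energy w f.
  exact: (fsum_translate (fun g => `|f g - f (g * w)%g| `^ p)).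
rewrite -fsumD//; last exact: energy_fin.
rewrite -fsumZ; last first.
  have [A fA] := (finite_suppP _).1 (energy_fin v ff).
  have [B fB] := (finite_suppP _).1 fw; apply/finite_suppP; exists (A `|` B)%fset => g.
  by rewrite !inE negb_or => /andP[/fA -> /fB ->]; rewrite addr0.
apply: fsum_le => [g|]; last first.
  have [A fA] := (finite_suppP _).1 (energy_fin v ff).
  have [B fB] := (finite_suppP _).1 fw; apply/finite_suppP; exists (A `|` B)%fset => g.
  by rewrite !inE negb_or => /andP[/fA -> /fB ->]; rewrite addr0 mulr0.
rewrite powR_ge0 /=; set b := f (g * v)%g.
set X := `|f g - b|; set Y := `|b - f (g * v * w)%g|.
have : `|f g - f (g * (v * w))%g| <= 2 * Num.max X Y.
  rewrite mulgA (le_trans (ler_distD b _ _))// mulr_natl mulr2n.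
  by rewrite lerD// le_max lexx ?orbT.
move=> le; have M0 : 0 <= Num.max X Y by rewrite le_max normr_ge0.
apply: (@le_trans _ _ ((2 * Num.max X Y) `^ p)).
  by rewrite ge0_ler_powR ?nnegrE ?mulr_ge0//; exact: ltW.
rewrite powRM// ler_wpM2l ?powR_ge0//; case: (leP X Y) => _.
  by rewrite lerDr powR_ge0.
by rewrite lerDl powR_ge0.
Qed.

Lemma energyV w f : energy w^-1 f = energy w f.
Proof.
rewrite /energy -[LHS](fsum_translate _ w); apply: eq_fsbigr => g _.
by rewrite mulgK distrC.
Qed.

Lemma energy1 f : energy 1 f = 0.
Proof. by rewrite /energy fsbig1// => g _; rewrite mulg1 subrr normr0 powR0// gt_eqF. Qed.

Lemma energy_generates S w : generates S -> exists2 L : R, 0 <= L &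
  forall f, finite_set (supp f) -> energy w f <= L * energies S f.
Proof.
move=> gS; have [n [u [_ uS ->]]] := gS w; elim: u uS => [|t u IH] /=.
  by exists 0 => // f _; rewrite big_nil energy1 mul0r.
move=> /andP[tS /IH[L L0 LP]]; rewrite big_cons; exists (2 `^ p * (1 + L)).
  by rewrite mulr_ge0 ?powR_ge0// addr_ge0.
move=> f ff; apply: (le_trans (energyM _ _ ff)).
rewrite -mulrA ler_wpM2l ?powR_ge0// mulrDl mul1r lerD//; last exact: LP.
have le s : s \in S -> energy s f <= energies S f.
  move=> sS; rewrite /energies (big_fsetD1 s)//= lerDl; apply: sumr_ge0 => h _.
  exact: energy_ge0.
by case/orP: tS => /le//; rewrite energyV.
Qed.

Lemma energies_generates S (T : eqType) (s : seq T) (h : T -> G) : generates S ->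
  exists2 L : R, 0 < L & forall f, finite_set (supp f) ->
    \sum_(t <- s) energy (h t) f <= L * energies S f.
Proof.
move=> gS; elim: s => [|t s [L L0 LP]].
  by exists 1 => // f _; rewrite big_nil mul1r energies_ge0.
have [K K0 KP] := energy_generates (h t) gS; exists (K + L); first by rewrite ltr_wpDl.
by move=> f ff; rewrite big_cons mulrDl lerD// ?KP ?LP.
Qed.

End Energy.

(** The quotients are compared by cross-multiplication because an energy may vanish, its quotient
    then being [+oo]; the hypothesis makes the energy of [f'] vanish whenever that of [f] does. *)
Lemma profile_compare (R : realType) (G G' : groupType) (p : R) (S : {fset G}) (S' : {fset G'})
    (x x' L : R) : 1 <= p -> 0 < L ->
  (forall f, admissible x f -> exists2 f', admissible x' f' &
     energies p S' f' * mass p f <= L * energies p S f * mass p f') ->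
  (profile p S x <= (L `^ p^-1)%:E * profile p S' x')%E.
Proof.
move=> p1 L0 cmp; have p0 : 0 < p := lt_le_trans ltr01 p1.
apply: ge_ereal_sup => _ [f fx <-].
have [f' fx' le] := cmp f fx.
have [_ f0 ff _] := fx; have [_ f0' ff' _] := fx'.
have m0 := mass_gt0 p1 ff f0; have m0' := mass_gt0 p1 ff' f0'.
apply: (@le_trans _ _ ((L `^ p^-1)%:E * ((norm_p p f')%:E / (grad_p p S' f')%:E))%E); last first.
  rewrite lee_pmul2l ?lte_fin ?powR_gt0//; apply: ereal_sup_ubound; by exists f'.
rewrite !norm_pE !grad_pE//.
have := energies_ge0 p S' f'; rewrite le_eqVlt => /orP[/eqP e0'|e0'].
  rewrite -e0' (@powR0 _ p^-1) ?invr_neq0 ?gt_eqF// inve0.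
  have pos (a : R) : 0 < a -> ((a `^ p^-1)%:E * +oo = +oo)%E.
    by move=> a0; rewrite gt0_muley// lte_fin powR_gt0.
  by rewrite !pos// leey.
have e0 : 0 < energies p S f.
  rewrite lt_neqAle energies_ge0 andbT eq_sym; apply: contraTneq le => ->.
  by rewrite mulr0 mul0r -ltNge mulr_gt0.
rewrite !inver !gt_eqF ?powR_gt0// -!EFinM lee_fin ler_pdivrMr ?powR_gt0//.
rewrite mulrA mulrAC ler_pdivlMr ?powR_gt0//.
rewrite -!powRM ?mulr_ge0//; try exact: ltW.
rewrite ge0_ler_powR ?invr_ge0// ?nnegrE; try by rewrite ?mulr_ge0// ltW.
by rewrite mulrC; apply: (le_trans le); rewrite mulrAC.
Qed.

(** * Isoperimetric inequalities and profiles *)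

Lemma seq_argmin (R : realType) (T : eqType) (s : seq T) (f : T -> R) : s != [::] ->
  exists2 x, x \in s & forall y, y \in s -> f x <= f y.
Proof.
elim: s => // x s IH _; have [->|/IH[y ys yP]] := eqVneq s [::].
  by exists x; rewrite ?mem_head// => y; rewrite inE => /eqP ->.
have [xy|/ltW yx] := leP (f x) (f y).
  exists x; rewrite ?mem_head// => z; rewrite inE => /orP[/eqP -> //|/yP].
  exact: le_trans.
by exists y; rewrite ?inE ?ys ?orbT// => z /orP[/eqP -> //|/yP].
Qed.

(** For [b <= a], Bernoulli's inequality bounds the difference by [N] times [a^(p-1) (a - b)]. This
    is absorbed by the first term if [lam * (a - b) <= a] and by the second otherwise. An integer
    [N] above [p] allows Bernoulli by induction. *)
Lemma powR_sub_le (R : realType) (p lam a b : R) (N : nat) :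
  1 <= p -> p <= N%:R -> 0 < lam -> 0 <= a -> 0 <= b ->
  `|a `^ p - b `^ p| <=
    N%:R * (a `^ p + b `^ p) / lam + N%:R * lam `^ (p - 1) * `|a - b| `^ p.
Proof.
move=> p1 pN lam0; wlog ba : a b / b <= a.
  move=> wl a0 b0; have [/wl|/ltW /wl] := leP b a; first exact.
  by rewrite (distrC (a `^ p)) (distrC a) [a `^ p + _]addrC; apply.
move=> a0 b0; have p0 : 0 < p by exact: lt_le_trans p1.
have [az|az] := eqVneq a 0.
  have -> : b = a by apply/le_anti; rewrite ba az b0.
  by rewrite subrr normr0 addr_ge0 ?mulr_ge0 ?invr_ge0 ?addr_ge0 ?powR_ge0//; exact: ltW.
have {az}a1 : 0 < a by rewrite lt_neqAle eq_sym az.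
have le : a `^ p - b `^ p <= N%:R * (a `^ (p - 1) * (a - b)).
  pose u := b / a; have u0 : 0 <= u by rewrite divr_ge0.
  have u1 : u <= 1 by rewrite ler_pdivrMr// mul1r.
  have bu : b = a * u by rewrite /u mulrCA mulfV ?mulr1// gt_eqF.
  have bern n : 1 - u ^+ n <= n%:R * (1 - u).
    elim: n => [|n IH]; first by rewrite expr0 subrr mul0r.
    have -> : 1 - u ^+ n.+1 = 1 - u + u * (1 - u ^+ n) by rewrite exprS; ring.
    rewrite -natr1 mulrDl mul1r addrC lerD2r; apply: le_trans IH.
    by rewrite ler_piMl// subr_ge0 exprn_ile1.
  have up : u ^+ N <= u `^ p.
    rewrite -powR_mulrn//; have [->|uz] := eqVneq u 0.
      by rewrite !powR0// gt_eqF// (lt_le_trans p0).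
    by apply: ger_powR => //; rewrite u1 lt_neqAle eq_sym uz u0.
  rewrite bu powRM// -{1}[a `^ p]mulr1 -mulrBr.
  have -> : N%:R * (a `^ (p - 1) * (a - a * u)) = (a * a `^ (p - 1)) * (N%:R * (1 - u)) by ring.
  rewrite mulr_powRB1// ler_wpM2l ?powR_ge0//; apply: le_trans (bern N).
  by rewrite lerD2l lerN2.
rewrite (ger0_norm (x := a - b)) ?subr_ge0// ger0_norm; last first.
  by rewrite subr_ge0 ge0_ler_powR ?nnegrE//; exact: ltW.
apply: (le_trans le).
have d0 : 0 <= a - b by rewrite subr_ge0.
have [dl|dl] := leP (lam * (a - b)) a.
  rewrite -[leLHS]addr0 lerD ?mulr_ge0 ?powR_ge0//.
  rewrite -mulrA ler_wpM2l// ler_pdivlMr//.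
  apply: (@le_trans _ _ (a `^ p)); last by rewrite lerDl powR_ge0.
  rewrite -(@mulr_powRB1 _ a p)// [a * _]mulrC -mulrA ler_wpM2l ?powR_ge0//.
  by rewrite mulrC.
rewrite -[leLHS]add0r lerD ?mulr_ge0 ?invr_ge0 ?addr_ge0 ?powR_ge0//; first exact: ltW.
rewrite -mulrA ler_wpM2l// -(@mulr_powRB1 _ (a - b) p)// [(a - b) * _]mulrC mulrA ler_wpM2r//.
rewrite -powRM//; last exact: ltW.
by rewrite ge0_ler_powR ?subr_ge0// ?nnegrE ?mulr_ge0//; exact: ltW.
Qed.

Section IsoperimetryProfile.
Variables (R : realType) (G : groupType).
Implicit Types (f : G -> R) (S A : {fset G}) (p x r : R).

Definition indic A : G -> R := fun g => (g \in A)%:R.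

Lemma indic_fin A : finite_set (supp (indic A)).
Proof. by apply/finite_suppP; exists A => g /negbTE; rewrite /indic => ->. Qed.

Lemma admissibleP x f : admissible x f <->
  [/\ forall g, 0 <= f g, exists g, f g != 0 &
    exists2 A, (forall g, g \notin A -> f g = 0) & #|` A|%:R <= x].
Proof.
split=> [[f0 fn ff fx]|[f0 fn [A fA Ax]]].
  split=> //; exists (fset_set (supp f)) => // g; rewrite in_fset_set// notin_setE /= => /negP.
  by rewrite negbK => /eqP.
have ff : finite_set (supp f) by apply/finite_suppP; exists A.
split=> //; apply: le_trans Ax; rewrite ler_nat; apply: fsubset_leq_card.
apply/fsubsetP => g; rewrite in_fset_set// inE /=.
by apply: contraNT => /fA ->.
Qed.

Lemma admissible_indic A x : A != fset0 -> #|` A|%:R <= x -> admissible x (indic A).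
Proof.
move=> /fset0Pn[g gA] Ax; apply/admissibleP; split.
- by move=> h; rewrite /indic ler0n.
- by exists g; rewrite /indic gA oner_neq0.
- by exists A => // h /negbTE; rewrite /indic => ->.
Qed.

Lemma mass_indic p A : 1 <= p -> mass p (indic A) = #|` A|%:R.
Proof.
move=> p1; have p0 : p != 0 by rewrite gt_eqF// (lt_le_trans ltr01).
rewrite /mass (fsbigTE A) => [|g /negbTE gA]; last by rewrite /indic gA normr0 powR0.
rewrite big_seq (eq_bigr (fun=> 1)) => [|g gA]; last by rewrite /indic gA normr1 powR1.
by rewrite -big_seq card_fset_sum1 natr_sum.
Qed.

Lemma energy_indic p A t : 1 <= p -> energy p t (indic A) = 2 * (bd A t)%:R.
Proof.
move=> p1; have p0 : p != 0 by rewrite gt_eqF// (lt_le_trans ltr01).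
pose F w g : R := ((g \in A) && ((g * w)%g \notin A))%:R.
have FA w g : g \notin A -> F w g = 0 by move=> /negbTE; rewrite /F => ->.
have Fbd w : \sum_(g \in [set: G]) F w g = (bd A w)%:R.
  rewrite (fsbigTE A)//; last exact: FA.
  rewrite /bd card_fset_cond natr_sum big_seq [RHS]big_seq; apply: eq_bigr => g gA.
  by rewrite /F gA.
have -> : energy p t (indic A) = \sum_(g \in [set: G]) (F t g + F t^-1%g (g * t)%g).
  apply: eq_fsbigr => g _; rewrite /indic /F mulgK.
  case: (g \in A); case: ((g * t)%g \in A); rewrite ?subrr ?subr0 ?sub0r ?normrN ?normr0 ?normr1 ?powR0 ?powR1 ?addr0 ?add0r//.
rewrite fsumD.
- by rewrite (fsum_translate (F t^-1%g)) !Fbd bdV -mulr2n mulr_natl.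
- by apply/finite_suppP; exists A; exact: FA.
- apply/finite_suppP; exists [fset (g * t^-1)%g | g in A]%fset => g gA; apply: FA.
  by apply: contra gA => gA; apply/imfsetP; exists (g * t)%g; rewrite //= mulgK.
Qed.

Lemma energies_indic p S A : 1 <= p -> energies p S (indic A) = 2 * (bdS A S)%:R.
Proof.
by move=> p1; rewrite /energies (eq_bigr _ (fun t _ => energy_indic A t p1)) -mulr_sumr natr_sum.
Qed.

Lemma profile1_isoper S x r : 0 <= r -> (profile 1 S x <= r%:E)%E -> isoper S x r.
Proof.
move=> r0 le A Ax; have [->|A0] := eqVneq A fset0.
  by rewrite cardfs0 !mulr_ge0.
rewrite leNgt; apply/negP => lt; set d := bdS A S in lt.
have ge r' : 0 <= r' -> 2 * r' * d%:R <= #|` A|%:R -> r' <= r.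
  move=> r'0 r'A; rewrite -lee_fin; apply: le_trans le.
  apply: (@profile_ge_fin _ _ _ _ S x r' (indic A)) => //; first exact: admissible_indic.
  by rewrite mass_indic// energies_indic// powRr1// mulrCA mulrA.
(* Without boundary every real is at most the profile; [r + 1] gives the contradiction. *)
have [d0|d0] := eqVneq d 0%N.
  have := ge (r + 1); rewrite d0 mulr0 addr_ge0//= => /(_ isT).
  by rewrite ler0n => /(_ isT); lra.
have d1 : 0 < d%:R :> R by rewrite ltr0n lt0n.
have : #|` A|%:R / (2 * d%:R) <= r.
  apply: ge; first by rewrite divr_ge0 ?mulr_ge0.
  rewrite le_eqVlt; apply/orP; left; apply/eqP; field.
  by rewrite gt_eqF.
rewrite ler_pdivrMr ?mulr_gt0// => /(lt_le_trans lt).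
by rewrite mulrCA mulrA ltxx.
Qed.

Lemma mass1E f : (forall g, 0 <= f g) -> mass 1 f = \sum_(g \in [set: G]) f g.
Proof.
by move=> f0; apply: eq_fsbigr => g _; rewrite powRr1 ?normr_ge0// ger0_norm.
Qed.

Lemma energy1E t f : energy 1 t f = \sum_(g \in [set: G]) `|f g - f (g * t)%g|.
Proof. by apply: eq_fsbigr => g _; rewrite powRr1. Qed.

(* Subtracting the minimum of [f] over its support decomposes [f] into indicators of level sets, along which mass and energy are additive. *)
Lemma coarea S x r A f : isoper S x r -> #|` A|%:R <= x ->
  (forall g, 0 <= f g) -> (forall g, g \notin A -> f g = 0) ->
  mass 1 f <= r * energies 1 S f.
Proof.
move=> iso; have [n] := ubnP #|` A|; elim: n A f => // n IH A f An Ax f0 fA.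
have [A0|A0] := eqVneq A fset0.
  have f00 g : f g = 0 by apply: fA; rewrite A0.
  rewrite mass1E// fsbig1//; rewrite /energies big1 ?mulr0// => t _.
  by rewrite energy1E fsbig1// => g _; rewrite !f00 subrr normr0.
have [g0 g0A g0min] : exists2 g, g \in A & forall h, h \in A -> f g <= f h.
  apply: (seq_argmin (s := enum_fset A)); apply: contraNneq A0 => A0.
  by apply/eqP/fsetP => g; rewrite inE -[g \in A]/(g \in enum_fset A) A0.
set c := f g0 in g0min.
pose f' g := f g - c * indic A g.
have f'0 g : 0 <= f' g.
  rewrite /f' /indic; case: (boolP (g \in A)) => [/g0min|/fA ->].
    by rewrite mulr1 subr_ge0.
  by rewrite mulr0 subr0.
have f'A g : g \notin (A `\ g0)%fset -> f' g = 0.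
  rewrite !inE negb_and negbK => /orP[/eqP ->|gA].
    by rewrite /f' /indic g0A mulr1 subrr.
  by rewrite /f' /indic (fA _ gA) (negbTE gA) mulr0 subrr.
have ff' : finite_set (supp f') by apply/finite_suppP; exists (A `\ g0)%fset.
have := IH (A `\ g0)%fset f'; have := cardfsD1 g0 A; rewrite g0A => cA.
move=> /(_ _ _ f'0 f'A) le'.
have {}le' : mass 1 f' <= r * energies 1 S f'.
  apply: le'; first by lia.
  by apply: le_trans Ax; rewrite ler_nat; lia.
have massE : mass 1 f = mass 1 f' + c * #|` A|%:R.
  rewrite -(mass_indic A (lexx 1)) !mass1E//.
  rewrite -fsumZ; last exact: indic_fin.
  rewrite -(@fsumD _ _ f' (fun g => c * indic A g))//; last first.
    by apply/finite_suppP; exists A => g /negbTE; rewrite /indic => ->; rewrite mulr0.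
  by apply: eq_fsbigr => g _; rewrite /f' subrK.
have energyE t : energy 1 t f = energy 1 t f' + c * energy 1 t (indic A).
  have fi : finite_set (supp (fun g => `|indic A g - indic A (g * t)%g|)).
    have := energy_fin (lexx 1) t (indic_fin A); congr finite_set.
    by congr supp; apply/funext => g; rewrite powRr1.
  have ff'' : finite_set (supp (fun g => `|f' g - f' (g * t)%g|)).
    have := energy_fin (lexx 1) t ff'; congr finite_set.
    by congr supp; apply/funext => g; rewrite powRr1.
  rewrite !energy1E -fsumZ//.
  rewrite -(@fsumD _ _ (fun g => `|f' g - f' (g * t)%g|) (fun g => c * `|indic A g - indic A (g * t)%g|))//; last first.
    have [B fB] := (finite_suppP _).1 fi.
    by apply/finite_suppP; exists B => g /fB ->; rewrite mulr0.
  apply: eq_fsbigr => g _.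
  have c0 : 0 <= c by exact: f0.
  have := f'0 g; have := f'0 (g * t)%g.
  rewrite /f' /indic; case: (boolP (g \in A)) => [gA|/fA ->];
    case: (boolP ((g * t)%g \in A)) => [gtA|/fA ->] /=;
    rewrite ?mulr0 ?mulr1 ?subr0 ?subrr ?normr0 ?mulr0 ?addr0 => h1 h2 //.
  - by congr (`|_|); ring.
  - by rewrite normr1 mulr1 !ger0_norm ?f0// subrK.
  - by rewrite !sub0r !normrN normr1 mulr1 !ger0_norm ?f0// subrK.
rewrite massE /energies (eq_bigr _ (fun t _ => energyE t)) big_split /= -mulr_sumr mulrDr lerD//.
rewrite -/(energies 1 S (indic A)) energies_indic// mulrCA ler_wpM2l ?f0//.
by rewrite mulrA [r * 2]mulrC; exact: iso.
Qed.

(* The isoperimetric inequality is applied to [f `^ p]; [powR_sub_le] stands in for Hoelder's inequality. *)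
Lemma isoper_profile p S : 1 <= p -> exists2 C : R, 0 < C &
  forall x r, 0 < r -> isoper S x r -> (profile p S x <= (C * r)%:E)%E.
Proof.
move=> p1; have p0 : 0 < p := lt_le_trans ltr01 p1.
pose N := (Num.trunc p).+1; have pN : p <= N%:R by rewrite ltW// truncnS_gt.
pose n : R := #|` S|%:R.
have C0 : 0 < 4 * N%:R * (n + 1) by rewrite !mulr_gt0// ?ltr0n// ltr_wpDl.
exists (4 * N%:R * (n + 1)) => // x r r0 iso.
(* This [lam] gives the mass on the right a coefficient at most 1/2, so that it can be absorbed;
   [n + 1] keeps it positive when [S] is empty. *)
set lam := 4 * N%:R * (n + 1) * r; have lam0 : 0 < lam by rewrite mulr_gt0.
apply: profile_le_fin => //; first exact: ltW.
move=> f /admissibleP[f0 fn [A fA Ax]].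
have ff : finite_set (supp f) by apply/finite_suppP; exists A.
have Fp0 g : 0 <= f g `^ p by exact: powR_ge0.
have FpA g : g \notin A -> f g `^ p = 0 by move=> /fA ->; rewrite powR0// gt_eqF.
have ffp : finite_set (supp (fun g => f g `^ p)) by apply/finite_suppP; exists A.
have massE : mass p f = \sum_(g \in [set: G]) f g `^ p.
  by apply: eq_fsbigr => g _; rewrite ger0_norm.
have := coarea iso Ax Fp0 FpA; rewrite mass1E// -massE => main.
have en t : energy 1 t (fun g => f g `^ p) <=
    (2 * N%:R / lam) * mass p f + N%:R * lam `^ (p - 1) * energy p t f.
  have ffpt : finite_set (supp (fun g => f (g * t)%g `^ p)).
    apply/finite_suppP; exists [fset (g * t^-1)%g | g in A]%fset => g gA; apply: FpA.
    by apply: contra gA => gA; apply/imfsetP; exists (g * t)%g; rewrite //= mulgK.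
  have ffs : finite_set (supp (fun g => f g `^ p + f (g * t)%g `^ p)).
    have [B fB] := (finite_suppP _).1 ffpt.
    apply/finite_suppP; exists (A `|` B)%fset => g.
    by rewrite !inE negb_or => /andP[/FpA -> /fB ->]; rewrite addr0.
  have fin1 (c : R) (F : G -> R) : finite_set (supp F) -> finite_set (supp (fun g => c * F g)).
    by move=> /finite_suppP[B fB]; apply/finite_suppP; exists B => g /fB ->; rewrite mulr0.
  have -> : 2 * N%:R / lam * mass p f + N%:R * lam `^ (p - 1) * energy p t f =
    \sum_(g \in [set: G]) (N%:R / lam * (f g `^ p + f (g * t)%g `^ p) +
       N%:R * lam `^ (p - 1) * `|f g - f (g * t)%g| `^ p).
    rewrite (@fsumD _ _ (fun g => N%:R / lam * (f g `^ p + f (g * t)%g `^ p))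
      (fun g => N%:R * lam `^ (p - 1) * `|f g - f (g * t)%g| `^ p)); last 2 first.
    - exact: fin1.
    - by apply: fin1; exact: energy_fin.
    rewrite fsumZ// fsumZ; last exact: energy_fin.
    rewrite (@fsumD _ _ (fun g => f g `^ p) (fun g => f (g * t)%g `^ p))//.
    rewrite (fsum_translate (fun g => f g `^ p)) -massE; congr (_ + _).
    by ring.
  rewrite energy1E; apply: fsum_le => [g|].
    rewrite normr_ge0 /=; apply: (le_trans (powR_sub_le p1 pN lam0 (f0 g) (f0 (g * t)%g))).
    by rewrite lerD2r [leLHS]mulrAC.
  have [B fB] := (finite_suppP _).1 ffs.
  have [B' fB'] := (finite_suppP _).1 (energy_fin p1 t ff).
  apply/finite_suppP; exists (B `|` B')%fset => g.
  by rewrite !inE negb_or => /andP[/fB -> /fB' ->]; rewrite !mulr0 addr0.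
have {}en : energies 1 S (fun g => f g `^ p) <=
    n * ((2 * N%:R / lam) * mass p f) + N%:R * lam `^ (p - 1) * energies p S f.
  have -> q : n * q = \sum_(t <- S) q.
    by rewrite /n card_fset_sum1 natr_sum mulr_suml; apply: eq_bigr => t _; rewrite mul1r.
  apply: (le_trans (ler_sum _ (fun t _ => en t))).
  by rewrite big_split /= -!mulr_sumr.
have m0 : 0 <= mass p f by exact: mass_ge0.
have e0 := energies_ge0 p S f.
have {main en} : mass p f <= 2^-1 * mass p f + 4^-1 * (lam `^ p * energies p S f).
  apply: (le_trans main); apply: (le_trans (ler_wpM2l (ltW r0) en)).
  have lp : lam `^ p = lam * lam `^ (p - 1) by rewrite mulr_powRB1// ltW.
  rewrite mulrDr lerD//.
    rewrite !mulrA ler_wpM2r// ler_pdivrMr// /lam.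
    have : 0 <= N%:R * r by rewrite mulr_ge0// ltW.
    have -> : 2^-1 * (4 * N%:R * (n + 1) * r) = (2 * (N%:R * r)) * n + 2 * (N%:R * r) by field.
    have -> : r * n * 2 * N%:R = (2 * (N%:R * r)) * n by ring.
    by move: (N%:R * r) => q q0; rewrite lerDl mulr_ge0.
  have X0 : 0 <= lam `^ (p - 1) * energies p S f by rewrite mulr_ge0 ?powR_ge0.
  have -> : r * (N%:R * lam `^ (p - 1) * energies p S f) =
     (r * N%:R) * (lam `^ (p - 1) * energies p S f) by ring.
  have -> : 4^-1 * (lam `^ p * energies p S f) =
     (4^-1 * lam) * (lam `^ (p - 1) * energies p S f) by rewrite lp; ring.
  rewrite ler_wpM2r// /lam.
  have -> : 4^-1 * (4 * N%:R * (n + 1) * r) = r * N%:R + (r * N%:R) * n by field.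
  by rewrite lerDl !mulr_ge0// ltW.
have : 0 <= lam `^ p * energies p S f by rewrite mulr_ge0// powR_ge0.
lra.
Qed.

End IsoperimetryProfile.

(** * The lower bound *)

(** Being carried by a finite set is only a predicate; restriction to that set is an injective code,
    which yields both finiteness and a count. *)
Lemma fset_of_code (X : choiceType) (T : finType) (P : X -> Prop) (c : X -> T) :
  (forall x y, P x -> P y -> c x = c y -> x = y) ->
  exists2 E : {fset X}, (forall x, x \in E <-> P x) & (#|` E| <= #|T|)%N.
Proof.
move=> cI.
have /choice[g gP] : forall t, exists o : option X,
    forall x, o = Some x <-> P x /\ c x = t.
  move=> t; have [[x [Px cx]]|no] := pselect (exists x, P x /\ c x = t).
    exists (Some x) => y; split=> [[<-]//|[Py cy]].
    by congr Some; apply: cI; rewrite // cx cy.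
  by exists None => x; split=> // Px; case: no; exists x.
exists [fset x in pmap g (enum T)]%fset.
  move=> x; rewrite inE /= mem_pmap; split=> [/mapP[t _ /esym/gP[]]//|Px].
  by apply/mapP; exists (c x); rewrite ?mem_enum//; apply/esym/gP.
rewrite card_fseq (leq_trans (size_undup _))// size_pmap (leq_trans (count_size _ _))//.
by rewrite -cardE.
Qed.

Lemma fsum_sdprod (R : realType) (H N : groupType) (a : autaction H N)
    (E : {fset N}) (A : {fset H}) (F : sdprod a -> R) :
  (forall u, sdl u \notin E -> F u = 0) -> (forall u, sdr u \notin A -> F u = 0) ->
  \sum_(u \in [set: sdprod a]) F u = \sum_(n <- E) \sum_(h <- A) F (SDProd a n h).
Proof.
move=> FE FA; pose s := [seq (SDProd a n h : sdprod a) | n <- enum_fset E, h <- enum_fset A].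
rewrite (fsbigTE [fset u in s]%fset) => [|u].
  rewrite -(@big_allpairs_dep _ _ _ _ _ _ (fun n h => (SDProd a n h : sdprod a)) (enum_fset E) (fun=> enum_fset A) F).
  apply: perm_big; apply: uniq_perm; first exact: fset_uniq.
    by apply: allpairs_uniq; rewrite ?fset_uniq// => -[n1 h1] [n2 h2] _ _ /= [-> ->].
  by move=> u; rewrite in_fset.
rewrite in_fset => us; have [uE|/FE//] := boolP (sdl u \in E); have [uA|/FA//] := boolP (sdr u \in A).
case/negP: us; apply/allpairsP; exists (sdl u, sdr u) => /=.
by split=> //; case: (u).
Qed.

Section LowerExtension.
(** [carried B n] is meant as: [n] moves nothing, and lights no lamp, outside [B]. The elements
    carried by a fixed [B] form a finite subgroup. *)
Variables (H N : groupType) (a : autaction H N) (carried : {fset H} -> N -> Prop).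
Hypothesis carried1 : forall B, carried B 1%g.
Hypothesis carriedM : forall B m n, carried B m -> carried B n -> carried B (m * n)%g.
Hypothesis carriedV : forall B n, carried B n -> carried B n^-1%g.
Hypothesis carried_act : forall B h n, carried B n ->
  carried [fset (h * b)%g | b in B]%fset (a h n).
Hypothesis carriedS : forall B B' n, (B `<=` B')%fset -> carried B n -> carried B' n.
Hypothesis carried_ex : forall n, exists B, carried B n.
Hypothesis carried_card : exists D : nat, forall B, exists2 E : {fset N},
  (forall n, n \in E <-> carried B n) & (#|` E| <= (D * #|` B|) ^ (D * #|` B|))%N.

Local Notation G := (sdprod a).

Lemma generates_sdr (SP : {fset G}) : generates SP ->
  generates [fset sdr u | u in SP]%fset.
Proof.
move=> gSP h; have [n [w [wn wS hE]]] := gSP (SDProd a 1%g h).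
exists n, [seq sdr u | u <- w]; split; first by rewrite size_map.
  rewrite all_map; apply/allP => u /(allP wS) /orP[uS|uS] /=.
    by apply/orP; left; apply/imfsetP; exists u.
  by apply/orP; right; apply/imfsetP; exists u^-1%g.
rewrite big_map -[h]/(sdr (SDProd a 1%g h)) hE.
by elim: {wn wS hE} w => [|u w IH]; rewrite ?big_nil// !big_cons /= IH.
Qed.

(* Functions on [H] supported by [A] are extended to pairs whose first component is carried by [A * T], where [T] is large enough for the generators to preserve this constraint. *)
Lemma profile_extension (R : realType) (p : R) (SH : {fset H}) (SP : {fset G}) :
  1 <= p -> generates SH ->
  exists C : R, exists D : nat, [/\ 0 < C, (0 < D)%N & forall (n : nat) (x : R),
    ((D * n) ^ (D * n))%:R <= x -> (profile p SH n%:R <= C%:E * profile p SP x)%E].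
Proof.
move=> p1 gSH; have p0 : 0 < p := lt_le_trans ltr01 p1.
have [D0 D0P] := carried_card.
(* The translates by [(sdr u)^-1] serve the steps [v -> v * u] of which only the endpoint is known
   to lie over the support: [sdl u] must then be located from that endpoint. *)
have [T TP] : exists T : {fset H}, forall u, u \in SP -> exists B, [/\ carried B (sdl u),
    (B `<=` T)%fset & ([fset ((sdr u)^-1 * b)%g | b in B] `<=` T)%fset].
  have : forall s : seq G, exists T : {fset H}, forall u, u \in s -> exists B, [/\ carried B (sdl u),
    (B `<=` T)%fset & ([fset ((sdr u)^-1 * b)%g | b in B] `<=` T)%fset].
    elim=> [|u s [T TP]]; first by exists fset0.
    have [B BP] := carried_ex (sdl u).
    exists (T `|` (B `|` [fset ((sdr u)^-1 * b)%g | b in B]))%fset => v.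
    rewrite inE => /orP[/eqP ->|/TP[B' [B'v B'T B'T']]].
      exists B; split=> //; apply/fsubsetP => h hB; rewrite !in_fsetU hB ?orbT//.
    exists B'; split=> //; first by apply: fsubset_trans B'T _; exact: fsubsetUl.
    by apply: fsubset_trans B'T' _; exact: fsubsetUl.
  by move=> /(_ (enum_fset SP)).
have [L L0 LP] := energies_generates p1 (enum_fset SP) (fun u : G => sdr u) gSH.
(* The successor pays for the second component: it has at most [n <= n ^ n] values. *)
exists (L `^ p^-1), (D0 * #|` T|).+1; split=> //; first exact: powR_gt0.
move=> n x nx; apply: profile_compare => // f /admissibleP[f0 [h0 fh0] [A fA An]].
have h0A : h0 \in A by apply: contraNT fh0 => /fA ->.
rewrite ler_nat in An.
pose B := [fset g in [seq (h * t)%g | h <- enum_fset A, t <- enum_fset T]]%fset.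
have BA : (#|` B| <= n * #|` T|)%N.
  rewrite card_fseq (leq_trans (size_undup _))// size_allpairs.
  by rewrite leq_mul2r An orbT.
have carriedB h C m : h \in A -> (C `<=` T)%fset -> carried C m -> carried B (a h m).
  move=> hA CT Cm; apply: carriedS (carried_act h Cm).
  apply/fsubsetP => g /imfsetP[t /= tC ->]; rewrite in_fset; apply/allpairsP.
  by exists (h, t); split=> //; exact: (fsubsetP CT).
have [E EP Ecard] := D0P B.
have E1 : 1%g \in E.
  by apply/EP; exact: carried1.
pose F (u : G) := f (sdr u) * (sdl u \in E)%:R.
have FE u : sdl u \notin E -> F u = 0 by move=> /negbTE uE; rewrite /F uE mulr0.
have FA u : sdr u \notin A -> F u = 0 by move=> /fA uA; rewrite /F uA mul0r.
have massF : mass p F = #|` E|%:R * mass p f.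
  rewrite /mass (fsum_sdprod (E := E) (A := A)) => [|u /FE ->|u /FA ->]; try by rewrite normr0 powR0// gt_eqF.
  rewrite (fsbigTE A) => [|h /fA ->]; last by rewrite normr0 powR0// gt_eqF.
  rewrite card_fset_sum1 natr_sum mulr_suml big_seq [RHS]big_seq; apply: eq_bigr => m mE.
  by rewrite mul1r; apply: eq_bigr => h _; rewrite /F /= mE mulr1.
(* [E] is a subgroup: over the support of [f], a step by [u] neither enters nor leaves it, so the
   first component creates no energy. *)
have energyF u : u \in SP -> energy p u F <= #|` E|%:R * energy p (sdr u) f.
  move=> uS; have [C [Cu CT CT']] := TP _ uS.
  pose A' := (A `|` [fset (h * (sdr u)^-1)%g | h in A])%fset.
  have fA' h : h \notin A' -> `|f h - f (h * sdr u)%g| `^ p = 0.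
    rewrite !inE negb_or => /andP[/fA -> hk]; rewrite fA ?subrr ?normr0 ?powR0 ?gt_eqF//.
    by apply: contra hk => hk; apply/imfsetP; exists (h * sdr u)%g; rewrite //= mulgK.
  pose Phi (v : G) := (sdl v \in E)%:R * `|f (sdr v) - f (sdr v * sdr u)%g| `^ p.
  have PhiE v : sdl v \notin E -> Phi v = 0 by move=> /negbTE vE; rewrite /Phi vE mul0r.
  have PhiA v : sdr v \notin A' -> Phi v = 0 by move=> /fA' vA; rewrite /Phi vA mulr0.
  have -> : #|` E|%:R * energy p (sdr u) f = \sum_(v \in [set: G]) Phi v.
    rewrite (fsum_sdprod PhiE PhiA).
    rewrite /energy (fsbigTE A')//.
    rewrite card_fset_sum1 natr_sum mulr_suml big_seq [RHS]big_seq; apply: eq_bigr => m mE.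
    by rewrite mul1r; apply: eq_bigr => h _; rewrite /Phi /= mE mul1r.
  apply: fsum_le => [v|]; last first.
    apply/finite_suppP; exists [fset v in [seq (SDProd a n h : G) | n <- enum_fset E, h <- enum_fset A']]%fset => v.
    rewrite in_fset => vs; have [vE|/PhiE//] := boolP (sdl v \in E).
    have [vA|/PhiA//] := boolP (sdr v \in A').
    by case/negP: vs; apply/allpairsP; exists (sdl v, sdr v); split=> //; case: (v).
  rewrite powR_ge0 /=; have [vE|vE] := boolP (sdl v \in E).
    rewrite /Phi vE mul1r ge0_ler_powR ?nnegrE//; first exact: ltW.
    rewrite /F vE mulr1 /=; have [vA|/fA ->] := boolP (sdr v \in A).
      have -> : (sdl v * a (sdr v) (sdl u))%g \in E.
        apply/EP; apply: carriedM; first exact/EP.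
        exact: carriedB Cu.
      by rewrite mulr1.
    rewrite !sub0r !normrN ger0_norm ?mulr_ge0// ger0_norm//.
    by rewrite ler_piMr// lern1 leq_b1.
  rewrite (PhiE v)// (FE v)// sub0r normrN.
  suff -> : F (v * u)%g = 0 by rewrite normr0 powR0// gt_eqF.
  rewrite /F /=; have [vA|/fA ->] := boolP ((sdr v * sdr u)%g \in A); last by rewrite mul0r.
  have [vuE|] := boolP (_ \in E); last by rewrite mulr0.
  case/negP: vE; apply/EP.
  rewrite -(mulgK (a (sdr v) (sdl u)) (sdl v)); apply: carriedM; first exact/EP.
  apply: carriedV.
  have -> : a (sdr v) (sdl u) = a (sdr v * sdr u)%g (a (sdr u)^-1%g (sdl u)).
    by rewrite lactM lactVK.
  exact: carriedB CT' (carried_act _ Cu).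
exists F.
  apply/admissibleP; split.
  - by move=> u; rewrite /F mulr_ge0.
  - by exists (SDProd a 1%g h0); rewrite /F /= E1 mulr1.
  exists [fset v in [seq (SDProd a n h : G) | n <- enum_fset E, h <- enum_fset A]]%fset => [v|].
    rewrite in_fset => vs; have [vE|/FE//] := boolP (sdl v \in E).
    have [vA|/FA//] := boolP (sdr v \in A).
    by case/negP: vs; apply/allpairsP; exists (sdl v, sdr v); split=> //; case: (v).
  apply: le_trans nx; rewrite ler_nat card_fseq (leq_trans (size_undup _))// size_allpairs.
  have n0 : (0 < n)%N by rewrite (leq_trans _ An)// cardfs_gt0; apply/fset0Pn; exists h0.
  set t := (D0 * #|` T|)%N.
  apply: (@leq_trans ((t.+1 * n) ^ (t * n) * (t.+1 * n) ^ n)); last first.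
    by rewrite -expnD mulSn addnC.
  apply: leq_mul.
    apply: (leq_trans Ecard); set b := (D0 * #|` B|)%N.
    have bt : (b <= t * n)%N by rewrite /b /t -mulnA leq_mul2l [(_ * n)%N]mulnC BA orbT.
    apply: (@leq_trans ((t.+1 * n) ^ b)); last by rewrite leq_pexp2l// muln_gt0.
    have : (b <= t.+1 * n)%N by rewrite (leq_trans bt)// leq_mul2r leqnSn orbT.
    by case: (b) => // b' bb'; rewrite leq_exp2r.
  apply: (leq_trans An); apply: (@leq_trans (n ^ n)); last by rewrite leq_exp2r// leq_pmull.
  by rewrite -{1}[n]expn1; case: (n) n0 => // k _; rewrite leq_pexp2l.
have ff : finite_set (supp f) by apply/finite_suppP; exists A.
have enF : energies p SP F <= #|` E|%:R * (L * energies p SH f).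
  apply: (@le_trans _ _ (\sum_(u <- SP) #|` E|%:R * energy p (sdr u) f)).
    by rewrite /energies big_seq [leRHS]big_seq; apply: ler_sum => u uS; exact: energyF.
  by rewrite -mulr_sumr ler_wpM2l//; exact: LP.
apply: (le_trans (ler_wpM2r (mass_ge0 p f) enF)); rewrite massF.
by rewrite le_eqVlt; apply/orP; left; apply/eqP; ring.
Qed.

End LowerExtension.

(** * Lampjuggler and lampdesigner groups *)

Section Transpositions.
Variable X : eqType.
Implicit Types (x y z : X).

Definition transp_fun x y z := if z == x then y else if z == y then x else z.

Lemma transp_funL x y : transp_fun x y x = y.
Proof. by rewrite /transp_fun eqxx. Qed.

Lemma transp_funR x y : transp_fun x y y = x.
Proof. by rewrite /transp_fun eqxx; case: eqP. Qed.

Lemma transp_funN x y z : z != x -> z != y -> transp_fun x y z = z.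
Proof. by rewrite /transp_fun => /negbTE -> /negbTE ->. Qed.

Fact transp_funK x y : involutive (transp_fun x y).
Proof.
move=> z; rewrite /transp_fun; have [->|zx] := eqVneq z x.
  by rewrite eqxx; case: eqP.
have [->|zy] := eqVneq z y; first by rewrite eqxx.
by rewrite (negbTE zx) (negbTE zy).
Qed.

Fact transp_fin x y : finite_set [set z | transp_fun x y z <> z].
Proof.
have : finite_set ([set x] `|` [set y]) by rewrite finite_setU; split; exact: finite_set1.
apply: sub_finite_set => z.
rewrite /transp_fun /=; case: eqP => [-> _|_]; first by left.
by case: eqP => [-> _|_ //]; right.
Qed.

Definition transp x y : FSym X :=
  MkFSym (transp_funK x y) (transp_funK x y) (transp_fin x y).

Lemma transp_mulK x y : (transp x y * transp x y = 1)%g.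
Proof. by apply: fsymP => z; exact: transp_funK. Qed.

Lemma transp_mul3 x y z : x != y -> y != z -> x != z ->
  transp x z = (transp x y * transp y z * transp x y)%g.
Proof.
move=> xy yz xz; apply: fsymP => t.
change (transp_fun x z t = transp_fun x y (transp_fun y z (transp_fun x y t))).
have [zx zy yx] : [/\ z != x, z != y & y != x] by rewrite ![_ == x]eq_sym [z == y]eq_sym.
have [->|tx] := eqVneq t x; first by rewrite !transp_funL transp_funN.
have [->|ty] := eqVneq t y; first by rewrite transp_funR !(transp_funN (z := y))// (transp_funN (z := x))// transp_funL.
have [->|tz] := eqVneq t z; first by rewrite transp_funR (transp_funN (z := z))// !transp_funR.
by rewrite !transp_funN.
Qed.

Lemma transp_conj (H : groupType) (a : laction H X) h x y :
  fs_conj a h (transp x y) = transp (a h x) (a h y).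
Proof.
apply: fsymP => z.
change (a h (transp_fun x y (a h^-1 z)%g) = transp_fun (a h x) (a h y) z).
have E t : (a h^-1%g z == t) = (z == a h t).
  by apply/eqP/eqP => [<-|->]; rewrite ?lactVK ?lactK.
by rewrite /transp_fun !E; case: eqP => // _; case: eqP => // _; rewrite lactVK.
Qed.

End Transpositions.

Lemma fsym_inj (X : Type) (s : FSym X) : injective s.
Proof. exact: can_inj (fs_funK s). Qed.

(** All that the asymptotic part uses about one extension [G] of [K]: finite generation of [K], the
    lower bound, and the isoperimetric step. The iteration then treats both constructions alike. *)
Definition extension_bounds (R : realType) (K G : groupType) (SP : {fset G}) : Prop :=
  [/\ exists SK : {fset K}, generates SK,
      forall (p : R) (SK : {fset K}), 1 <= p -> generates SK ->
        exists C : R, exists D : nat, [/\ 0 < C, (0 < D)%N & forall (n : nat) (x : R),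
          ((D * n) ^ (D * n))%:R <= x -> (profile p SK n%:R <= C%:E * profile p SP x)%E] &
      forall SK : {fset K}, exists2 C : R, 0 < C &
        forall (m r x : R) (n b k : nat) (B : {fset K}),
        n%:R <= r -> isoper SK m r -> (16 * k)%:R <= m ->
        (0 < b)%N -> (8 * b <= #|` B|)%N ->
        (forall y, y \in B -> y != 1%g /\ word_ball SK n y) ->
        x < (b ^ k)%:R -> isoper SP x (C * r)].

Section ShufflerBounds.
Variables (s : nat) (K : groupType).
Local Notation a := (LAction (@lmul_sheets1 s K) (@lmul_sheetsM s K)).
Local Notation aa := (fsym_autaction a).

Definition shuffler_carried (B : {fset K}) (f : FSym (K * 'I_s)) : Prop :=
  forall z, z.1 \notin B -> f z = z.

Lemma shuffler_carried_stable B f z : shuffler_carried B f -> z.1 \in B -> (f z).1 \in B.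
Proof.
move=> fB zB; apply: contraT => fzB; have fz : f z = z by apply: (@fsym_inj _ f); exact: fB.
by rewrite fz zB in fzB.
Qed.

Lemma shuffler_carried_card : exists D : nat, forall B, exists2 E : {fset FSym (K * 'I_s)},
  (forall f, f \in E <-> shuffler_carried B f) & (#|` E| <= (D * #|` B|) ^ (D * #|` B|))%N.
Proof.
(* A permutation carried by [B] restricts to a self-map of the points above [B], [s] for each
   element of [B]; [insubd] never takes its default value on it. *)
exists s => B.
pose c (f : FSym (K * 'I_s)) : {ffun B * 'I_s -> B * 'I_s} :=
  [ffun z => (insubd z.1 (f (val z.1, z.2)).1, (f (val z.1, z.2)).2)].
have cI f g : shuffler_carried B f -> shuffler_carried B g -> c f = c g -> f = g.
  move=> fB gB cfg; apply: fsymP => -[h i].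
  have [hB|hB] := boolP (h \in B); last by rewrite fB// gB.
  have := congr1 (fun u : {ffun _ -> _} => u ([` hB]%fset, i)) cfg.
  rewrite !ffunE /= => -[/(congr1 val) e1 e2].
  rewrite !val_insubd !(shuffler_carried_stable (z := (h, i)))// in e1.
  by case: (f (h, i)) (g (h, i)) e1 e2 => [? ?] [? ?] /= -> ->.
have [E EP Ec] := fset_of_code cI.
exists E => //; apply: (leq_trans Ec).
by rewrite card_ffun card_prod card_ord -cardfE mulnC.
Qed.

Lemma Shuffler_extension_bounds (R : realType) (SP : {fset Shuffler s K}) :
  (0 < s)%N -> generates SP -> extension_bounds R K SP.
Proof.
move=> s0 gSP; split.
- by eexists; exact: generates_sdr gSP.
- move=> p SK p1 gSK; apply: (profile_extension (carried := shuffler_carried)) => //.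
  + by move=> B f g fB gB z zB; rewrite -[LHS]/(f (g z)) gB// fB.
  + by move=> B f fB z zB; rewrite -[LHS]/(fs_inv f z) -[z in LHS]fB// fs_funK.
  + move=> B h f fB z zB; change (a h (f (a h^-1%g z)) = z); rewrite fB ?lactVK//=.
    apply: contra zB => zB; apply/imfsetP; exists (h^-1 * z.1)%g => //.
    by rewrite mulVKg.
  + by move=> B B' f /fsubsetP BB' fB z zB; apply: fB; apply: contra zB; exact: BB'.
  + move=> f; have /finite_fsetP[Y YP] := fs_fin f.
    exists [fset z.1 | z in Y]%fset => z zY; apply: contrapT => fz.
    have : [set` Y]%classic z by rewrite -YP.
    by move=> /= zY'; case/negP: zY; apply/imfsetP; exists z.
  + exact: shuffler_carried_card.
(* Positions and swaps use the single sheet [i0], whereas labels range over all sheets. *)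
move=> SK; pose i0 := Ordinal s0.
have act h h' : a h (h', i0) = ((h * h')%g, i0) by [].
apply: (isoper_swap_extension (L := (K * 'I_s)%type)
  (lab := fun (f : FSym (K * 'I_s)) h => f (h, i0))
  (swap := fun y => transp (1%g : K, i0) (y, i0))) => //.
- by move=> f h h' e; have [] := @fsym_inj _ f (h, i0) (h', i0) e.
- move=> f h y.
  change (f (fs_conj a h (transp (1%g, i0) (y, i0)) (h, i0)) = f ((h * y)%g, i0)).
  by rewrite transp_conj /= /lmul_sheets /= mulg1 /transp_fun eqxx.
- move=> f h y z zh zy.
  change (f (fs_conj a h (transp (1%g, i0) (y, i0)) (z, i0)) = f (z, i0)).
  rewrite transp_conj /= /lmul_sheets /= mulg1 /transp_fun.
  by rewrite !xpair_eqE (negbTE zh) (negbTE zy).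
- by move=> y; exact: transp_mulK.
move=> k y k1 y1 ky1.
change (transp (1%g, i0) ((k * y)%g, i0) = transp (1%g, i0) (k, i0) *
  fs_conj a k (transp (1%g, i0) (y, i0)) * transp (1%g, i0) (k, i0))%g.
rewrite transp_conj /= /lmul_sheets /= mulg1; apply: transp_mul3.
- by rewrite xpair_eqE eqxx andbT eq_sym.
- rewrite xpair_eqE eqxx andbT; apply: contra y1 => /eqP e.
  by apply/eqP; apply: (@mulgI _ k); rewrite mulg1.
- by rewrite xpair_eqE eqxx andbT eq_sym.
Qed.

End ShufflerBounds.

Section DesignerBounds.
Variables (F : finGroupType) (K : groupType).
Local Notation l := (lmul_laction K).
Local Notation W := (fsym_wreath F K).
Local Notation aa := (@AutAction K W (LAction (@wreath_act1 F K) (@wreath_actM F K)) (@wreath_actMr F K)).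
Local Notation lampless f := (SDProd _ 1%g f : W).

Definition designer_carried (B : {fset K}) (w : W) : Prop :=
  forall z, z \notin B -> sdl w z = 1%g /\ sdr w z = z.

Lemma designer_carried_stable B w z : designer_carried B w -> z \in B -> sdr w z \in B.
Proof.
move=> wB zB; apply: contraT => wzB; have wz : sdr w z = z.
  by apply: (@fsym_inj _ (sdr w)); have [] := wB _ wzB.
by rewrite wz zB in wzB.
Qed.

Lemma designer_carried_card : exists D : nat, forall B, exists2 E : {fset W},
  (forall w, w \in E <-> designer_carried B w) & (#|` E| <= (D * #|` B|) ^ (D * #|` B|))%N.
Proof.
exists #|F| => B.
pose c (w : W) : {ffun B -> F} * {ffun B -> B} :=
  ([ffun z => sdl w (val z)], [ffun z => insubd z (sdr w (val z))]).
have cI v w : designer_carried B v -> designer_carried B w -> c v = c w -> v = w.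
  case: v w => [f s] [g t] vB wB [/ffunP cfg /ffunP cst].
  have -> : f = g.
    apply: dsumP => h; have [hB|hB] := boolP (h \in B).
      by have := cfg [` hB]%fset; rewrite !ffunE.
    by have [/= -> _] := vB _ hB; have [/= -> _] := wB _ hB.
  have -> // : s = t.
  apply: fsymP => h; have [hB|hB] := boolP (h \in B).
    have := cst [` hB]%fset; rewrite !ffunE /= => /(congr1 val).
    rewrite !val_insubd /= (designer_carried_stable vB hB).
    by rewrite (designer_carried_stable wB hB).
  by have [_ /= ->] := vB _ hB; have [_ /= ->] := wB _ hB.
have [E EP Ec] := fset_of_code cI.
exists E => //; apply: (leq_trans Ec).
(* With [f] and [b] the sizes of [F] and [B], there are [(f b)^b] codes; enlarging the exponent to
   [f b] gives the common form of the bound, and [b = 0] is treated apart. *)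
rewrite card_prod !card_ffun -cardfE -expnMn.
have F0 : (0 < #|F|)%N by apply/card_gt0P; exists 1%g.
case: (#|` B|) => [|n]; first by rewrite muln0.
by rewrite leq_pexp2l// ?muln_gt0 ?F0// leq_pmull.
Qed.

Lemma Designer_extension_bounds (R : realType) (SP : {fset Designer F K}) :
  generates SP -> extension_bounds R K SP.
Proof.
move=> gSP; split.
- by eexists; exact: generates_sdr gSP.
- move=> p SK p1 gSK; apply: (profile_extension (carried := designer_carried)) => //.
  + move=> B [f s] [g t] /= vB wB z zB.
    have [/= fz sz] := vB _ zB; have [/= gz tz] := wB _ zB.
    have sz' : fs_inv s z = z by rewrite -[z in LHS]sz fs_funK.
    split; last by rewrite -[LHS]/(s (t z)) tz.
    change (f z * g (fs_inv s z) = 1)%g.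
    by rewrite sz' fz gz mulg1.
  + move=> B [f s] vB z zB; have [/= fz sz] := vB _ zB.
    have sz' : fs_inv s z = z by rewrite -[z in LHS]sz fs_funK.
    split; last by [].
    change ((f (fs_inv (fs_invg s) z))^-1 = 1)%g.
    by rewrite /= sz fz invg1.
  + move=> B h [f s] vB z zB; have hzB : (h^-1 * z)%g \notin B.
      by apply: contra zB => zB; apply/imfsetP; exists (h^-1 * z)%g => //; rewrite mulVKg.
    have [/= fz sz] := vB _ hzB; split; first exact: fz.
    change ((h * s (h^-1 * z)) = z)%g.
    by rewrite sz mulVKg.
  + by move=> B B' w /fsubsetP BB' wB z zB; apply: wB; apply: contra zB; exact: BB'.
  + move=> [f s]; have /finite_fsetP[Y YP] := fs_fin s; have /finite_fsetP[Z ZP] := ds_fin f.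
    exists (Z `|` Y)%fset => z; rewrite in_fsetU negb_or => /andP[zZ zY]; split; apply: contrapT => fz.
      have : [set` Z] z by rewrite -ZP.
      by rewrite /= (negbTE zZ).
    have : [set` Y] z by rewrite -YP.
    by rewrite /= (negbTE zY).
  + exact: designer_carried_card.
move=> SK.
(* Labels are the values of the permutation, and swaps carry trivial lamps. *)
apply: (isoper_swap_extension (L := K)
  (lab := fun (w : W) h => sdr w h)
  (swap := fun y => lampless (transp (1%g : K) y))) => //.
- by move=> w h h' /(@fsym_inj _ (sdr w)).
- move=> w h y.
  change (sdr w (fs_conj l h (transp 1%g y) h) = sdr w (h * y)%g).
  by rewrite transp_conj /= mulg1 transp_funL.
- move=> w h y z zh zy.
  change (sdr w (fs_conj l h (transp 1%g y) z) = sdr w z).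
  by rewrite transp_conj /= mulg1 transp_funN.
- move=> y; rewrite -[LHS]/(sd_mul _ _) /sd_mul /= transp_mulK.
  by rewrite -[RHS]/(sd_one _) /sd_one mul1g; congr SDProd; exact: dsumP.
move=> k y k1 y1 ky1.
have -> : transp 1%g (k * y)%g = (transp 1%g k *
  fs_conj l k (transp 1%g y) * transp 1%g k)%g.
  rewrite transp_conj /= mulg1; apply: transp_mul3.
  - by rewrite eq_sym.
  - by apply: contra y1 => /eqP e; apply/eqP; apply: (@mulgI _ k); rewrite mulg1.
  - by rewrite eq_sym.
apply/esym; rewrite -[LHS]/(sd_mul (sd_mul _ _) _) /sd_mul /=; congr SDProd.
by apply: dsumP => z /=; rewrite /= !mulg1.
Qed.

End DesignerBounds.

(** * Amenability and polynomial growth *)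

Section ProfileBounds.
Variables (R : realType) (G : groupType).
Implicit Types (S A : {fset G}) (p x r : R).

(** For [x < 1] no function is admissible and the supremum is [-oo]: later nonnegativity statements
    hold only near infinity. *)
Lemma profile_ge0 p S x : 1 <= p -> 1 <= x -> (0 <= profile p S x)%E.
Proof.
move=> p1 x1; apply: (le_trans (ratio_ge0 p S (indic R [fset 1%g]%fset))).
apply: ereal_sup_ubound; exists (indic R [fset 1%g]%fset) => //.
by apply: admissible_indic; rewrite ?cardfs1//; apply/fset0Pn; exists 1%g; rewrite inE.
Qed.

Lemma profile1_ge_set S A x r : 0 <= r -> A != fset0 -> #|` A|%:R <= x ->
  2 * r * (bdS A S)%:R <= #|` A|%:R -> (r%:E <= profile 1 S x)%E.
Proof.
move=> r0 A0 Ax le; apply: (@profile_ge_fin _ _ _ (lexx 1) S x r (indic R A)) => //.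
  exact: admissible_indic.
by rewrite mass_indic// energies_indic// powRr1// mulrCA mulrA.
Qed.

Lemma profile1_gt0 S x : 1 <= x -> (0%:E < profile 1 S x)%E.
Proof.
move=> x1; pose n : R := #|` S|%:R; have n1 : 0 < n + 1 by rewrite ltr_wpDl.
apply: (@lt_le_trans _ _ (2^-1 / (n + 1))%:E); first by rewrite lte_fin divr_gt0.
apply: (@profile1_ge_set S [fset 1%g]%fset); rewrite ?cardfs1//.
- by rewrite divr_ge0// ltW.
- by apply/fset0Pn; exists 1%g; rewrite inE.
have -> : 2 * (2^-1 / (n + 1)) = (n + 1)^-1 by field; rewrite gt_eqF.
rewrite mulrC ler_pdivrMr// mul1r.
rewrite natr1 ler_nat /bdS (@leq_trans #|` S|)// card_fset_sum1; apply: leq_sum => t _.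
have := bd_cardE [fset 1%g]%fset t; rewrite cardfs1 => <-; exact: leq_addr.
Qed.

Lemma isoperS S x r r' : r <= r' -> isoper S x r -> isoper S x r'.
Proof.
move=> rr' iso A /iso le; apply: (le_trans le).
by rewrite ler_wpM2r// ler_wpM2l.
Qed.

Lemma profile_le_profile1 p S : 1 <= p -> exists2 C : R, 0 < C &
  forall x, 1 <= x -> (profile p S x <= C%:E * profile 1 S x)%E.
Proof.
move=> p1; have [C C0 CP] := isoper_profile S p1; exists C => // x x1.
have := profile1_gt0 S x1; have := fun r => @profile1_isoper _ _ S x r.
case: (profile 1 S x) => [r isor r0||] //; last by rewrite gt0_muley ?lte_fin// leey.
by rewrite lte_fin in r0; rewrite -EFinM; apply: CP => //; apply: isor => //; exact: ltW.
Qed.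

Lemma profile_generates p S S' : 1 <= p -> generates S -> exists2 C : R, 0 < C &
  forall x, (profile p S x <= C%:E * profile p S' x)%E.
Proof.
move=> p1 gS; have [L L0 LP] := energies_generates p1 (enum_fset S') id gS.
exists (L `^ p^-1); rewrite ?powR_gt0// => x.
apply: profile_compare => // f fx; exists f => //; rewrite ler_wpM2r ?mass_ge0//.
by have [_ _ ff _] := fx; exact: LP.
Qed.

(** The form in which amenability is used and passes to the iterates: it makes the radius of a fixed
    finite set eventually smaller than the profile. *)
Definition unbounded_profile S := forall M : R, exists x, (M%:E <= profile 1 S x)%E.

Lemma amenable_unbounded S : amenable R G -> unbounded_profile S.
Proof.
move=> am M; pose n : R := #|` S|%:R; pose M' := Num.max M 1.
have M'0 : 0 < M' by rewrite lt_max ltr01 orbT.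
have n1 : 0 < n + 1 by rewrite ltr_wpDl.
have e0 : 0 < (2 * M' * (n + 1))^-1 by rewrite invr_gt0 !mulr_gt0.
have [A [A0 AP]] := am S _ e0.
exists #|` A|%:R; apply: (@le_trans _ _ M'%:E); first by rewrite lee_fin le_max lexx.
apply: (@profile1_ge_set S A) => //; first exact: ltW.
have : (bdS A S)%:R <= n * ((2 * M' * (n + 1))^-1 * #|` A|%:R).
  have -> q : n * q = \sum_(k <- S) q.
    by rewrite /n card_fset_sum1 natr_sum mulr_suml; apply: eq_bigr => k _; rewrite mul1r.
  rewrite /bdS natr_sum big_seq [leRHS]big_seq.
  by apply: ler_sum => k kS; exact: AP.
have c0 : 0 <= 2 * M' by rewrite mulr_ge0// ltW.
move=> /(ler_wpM2l c0) le; apply: (le_trans le).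
have -> : 2 * M' * (n * ((2 * M' * (n + 1))^-1 * #|` A|%:R)) = #|` A|%:R * (n / (n + 1)).
  by field; rewrite !gt_eqF.
by rewrite ler_piMr// ler_pdivrMr// mul1r lerDl.
Qed.

(* On a finite group, the indicator of the whole group has zero gradient. *)
Lemma profile1_finite_pinfty S : finite_set [set: G] -> exists x : R, profile 1 S x = +oo%E.
Proof.
move=> fG; exists #|` fset_set [set: G]|%:R; apply/eqyP => r r0.
have inA g : g \in fset_set [set: G] by rewrite in_fset_set// inE.
apply: (@profile1_ge_set S (fset_set [set: G])) => //; first exact: ltW.
  by apply/fset0Pn; exists 1%g.
suff -> : bdS (fset_set [set: G]) S = 0%N by rewrite mulr0.
rewrite /bdS big1// => t _; apply/eqP; rewrite cardfs_eq0; apply/eqP/fsetP => g.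
by rewrite in_fset0; apply/negP; rewrite inE => /andP[_]; rewrite inA.
Qed.

Section PolynomialGrowth.
Variables (S : {fset G}) (d : nat).
Hypotheses (d1 : (1 <= d)%N) (gr : polynomial_growth R S d).

Definition ball n : {fset G} := fset_set (word_ball S n).

Let d0 : 0 < d%:R :> R. Proof. by rewrite ltr0n. Qed.

(** [card_set] is 0 on an infinite set, which the positive lower bound on growth excludes. *)
Lemma word_ball_fin n : (0 < n)%N -> finite_set (word_ball S n).
Proof.
move=> n0; have [c [C [c0 C0 /(_ n n0) /andP[le _]]]] := gr.
apply: contrapT => inf; move: le; rewrite /card_set /fset_set; case: pselect => // _; rewrite cardfs0 leNgt.
by rewrite mulr_gt0// exprn_gt0// ltr0n.
Qed.

Lemma ballP n g : (0 < n)%N -> g \in ball n <-> word_ball S n g.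
Proof. by move=> /word_ball_fin fn; rewrite /ball in_fset_set// inE. Qed.

Lemma powR_root (x : R) : 0 <= x -> (x `^ d%:R^-1) ^+ d = x.
Proof. by move=> x0; rewrite -powR_mulrn ?powR_ge0// -powRrM mulVf ?powRr1// gt_eqF. Qed.

(* Among the translates of [A] by the elements of a ball with at least [2 #|A|] elements, one is half disjoint from [A]. *)
Lemma poly_growth_isoper : exists2 C : R, 0 < C & forall m : R, 1 <= m ->
  isoper S m (C * m `^ d%:R^-1).
Proof.
have [c [C [c0 C0 cC]]] := gr.
exists ((2 / c) `^ d%:R^-1 + 1) => [|m m1 A Am]; first by rewrite ltr_wpDl ?powR_ge0.
have m0 : 0 < m := lt_le_trans ltr01 m1.
have q0 : 0 <= (2 * m / c) `^ d%:R^-1 by exact: powR_ge0.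
(* This radius gives [c n^d >= 2 m], hence a ball at least twice as large as [A]. *)
pose n := (Num.trunc ((2 * m / c) `^ d%:R^-1)).+1.
have nle : n%:R <= ((2 / c) `^ d%:R^-1 + 1) * m `^ d%:R^-1.
  have -> : n%:R = (Num.trunc ((2 * m / c) `^ d%:R^-1))%:R + 1 :> R by rewrite natr1.
  rewrite [leRHS]mulrDl mul1r lerD//.
    rewrite -powRM ?divr_ge0//; try exact: ltW.
    by rewrite [2 / c * m]mulrAC truncn_le.
  by rewrite -[leLHS](powRr0 m) ler_powR// invr_ge0 ltW.
suff : #|` A|%:R <= 2 * n%:R * (bdS A S)%:R :> R.
  by move=> le; apply: (le_trans le); rewrite ler_wpM2r// ler_wpM2l.
have n0 : (0 < n)%N by [].
have mB : 2 * #|` A|%:R <= #|` ball n|%:R :> R.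
  have /andP[+ _] := cC n n0; apply: le_trans.
  apply: (@le_trans _ _ (2 * m)); first by rewrite ler_wpM2l.
  rewrite [c * _]mulrC -ler_pdivrMr// -[2 * m / c]powR_root ?divr_ge0 ?mulr_ge0//; try exact: ltW.
  by rewrite lerXn2r ?nnegrE// ltW// truncnS_gt.
have {mB} AB : (2 * #|` A| <= #|` ball n|)%N by rewrite -(ler_nat R) natrM.
rewrite -natrM -natrM ler_nat.
have [->|A0] := eqVneq A fset0; first by rewrite cardfs0.
have Apos : (0 < #|` A|)%N by rewrite cardfs_gt0.
have Bpos : (0 < #|` ball n|)%N by rewrite (leq_trans _ AB)// muln_gt0.
(* For each [g] in [A], at most as many [y] as [A] has elements keep [g * y] in [A]: at most half of
   the ball. *)
have : (\sum_(y <- ball n) #|` [fset g in A | (g * y)%g \in A]%fset| <= #|` A| * #|` A|)%N.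
  under eq_bigr do rewrite card_fset_cond.
  rewrite exchange_big /= -[X in (_ <= X * _)%N]sum1_size big_distrl /=; apply: leq_sum => g _.
  rewrite mul1n -card_fset_cond.
  rewrite -(card_fimage_inj (f := fun y => (g * y)%g)) => [|? ? _ _ /mulgI//].
  apply: fsubset_leq_card; apply/fsubsetP => h /imfsetP[y /= + ->].
  by rewrite inE => /andP[].
have : (\sum_(y <- ball n) bd A y <= #|` ball n| * (n * bdS A S))%N.
  rewrite -sum1_size big_distrl /= big_seq [leqRHS]big_seq; apply: leq_sum => y yB.
  by rewrite mul1n; apply: bd_word_ball; exact/ballP.
have : (\sum_(y <- ball n) bd A y + \sum_(y <- ball n) #|` [fset g in A | (g * y)%g \in A]%fset| =
   #|` ball n| * #|` A|)%N.
  rewrite -big_split /= (eq_bigr (fun=> #|` A|)) => [|y _]; last exact: bd_cardE.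
  by rewrite -[#|` ball n|]sum1_size big_distrl /=; apply: eq_bigr => y _; rewrite mul1n.
move: (\sum_(_ <- _) _)%N (\sum_(_ <- _) _)%N (bdS A S) => s1 s2 e e12 le1 le2.
have le3 : (#|` ball n| * #|` A| <= #|` ball n| * (n * e) + #|` A| * #|` A|)%N.
  by rewrite -e12 leq_add.
have le4 : (2 * (#|` A| * #|` A|) <= #|` ball n| * #|` A|)%N by rewrite mulnA leq_mul2r AB orbT.
rewrite -(leq_pmul2l Bpos); have -> : (#|` ball n| * (2 * n * e) = 2 * (#|` ball n| * (n * e)))%N by ring.
move: le3 le4; move: (#|` ball n| * (n * e))%N (#|` ball n| * _)%N (#|` A| * _)%N => u v w.
by clear; lia.
Qed.

Lemma ball_bd n t : (0 < n)%N -> t \in S -> (#|` ball n| + bd (ball n) t <= #|` ball n.+1|)%N.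
Proof.
move=> n0 tS; pose Z := [fset (g * t)%g | g in [fset g in ball n | (g * t)%g \notin ball n]]%fset.
have -> : bd (ball n) t = #|` Z| by rewrite card_fimage_inj// => ? ? _ _ /mulIg.
have /eqP <- : #|` (ball n `|` Z)%fset| == (#|` ball n| + #|` Z|)%N.
  rewrite (leq_card_fsetU _ _).2 -fsetI_eq0; apply/eqP/fsetP => g; rewrite in_fsetI in_fset0.
  apply/negP => /andP[gB /imfsetP[h /=]].
  by rewrite inE => /andP[_ /negP hB] gE; apply: hB; rewrite -gE.
apply: fsubset_leq_card; apply/fsubsetP => g; rewrite in_fsetU => /orP[|/imfsetP[h /=]].
  by move=> /ballP gn; apply/ballP => //; apply: word_ballS (gn n0); exact: leqnSn.
rewrite inE => /andP[/ballP hn _] ->; apply/ballP => //.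
by rewrite -addn1; apply: word_ballM; [exact: hn|exact: word_ball_gen].
Qed.

(** The test set is a ball of radius [i] with [n <= i < 2 n]. Passing from [i] to [i + 1] adds at
    least the boundary along each generator; were all these boundaries large, their sum would exceed
    the size of the ball of radius [2 n]. *)
Lemma poly_growth_profile_ge : exists2 c : R, 0 < c &
  \forall m \near +oo, ((c * m `^ d%:R^-1)%:E <= profile 1 S m)%E.
Proof.
have [c [C [c0 C0 cC]]] := gr.
pose s : R := #|` S|%:R.
pose q : R := C `^ d%:R^-1.
have q0 : 0 < q by exact: powR_gt0.
pose K : R := 2 * (s + 1) * C * 2 ^+ d.
have s0 : 0 < s + 1 by rewrite ltr_wpDl.
have K0 : 0 < K by rewrite !mulr_gt0// exprn_gt0.
exists (c / K / (4 * q)); first by rewrite !divr_gt0// mulr_gt0.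
near=> m.
have m1 : (2 * q) ^+ d <= m by near: m; apply: nbhs_pinfty_ge; rewrite num_real.
have m0 : 0 <= m by apply: le_trans m1; rewrite exprn_ge0// mulr_ge0// ltW.
(* Since [q] is the d-th root of [C], balls of radius at most [2 n] have at most [m] elements. *)
pose n := Num.trunc (m `^ d%:R^-1 / (2 * q)).
have w1 : 1 <= m `^ d%:R^-1 / (2 * q).
  rewrite ler_pdivlMr ?mulr_gt0// mul1r -(ler_pXn2r (n := d)) ?nnegrE ?powR_ge0//.
    by rewrite powR_root.
  by rewrite mulr_ge0// ltW.
have n0 : (0 < n)%N by rewrite truncn_gt0.
have nle : n%:R <= m `^ d%:R^-1 / (2 * q) by rewrite truncn_le (le_trans ler01).
have nge : m `^ d%:R^-1 / (4 * q) <= n%:R.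
  have : m `^ d%:R^-1 / (2 * q) < n%:R + 1 by rewrite natr1 truncnS_gt.
  have -> : m `^ d%:R^-1 / (2 * q) = 2 * (m `^ d%:R^-1 / (4 * q)) by field; rewrite gt_eqF.
  by have : 1 <= n%:R :> R by [rewrite ler1n]; lra.
have [i [ni i2n ile]] : exists i, [/\ (n <= i)%N, (i < 2 * n)%N &
    (n * bdS (ball i) S <= #|` S| * #|` ball (2 * n)|)%N].
  apply: contrapT => no.
  have big i : (n <= i)%N -> (i < 2 * n)%N -> (#|` S| * #|` ball (2 * n)| < n * bdS (ball i) S)%N.
    by move=> ni i2n; rewrite ltnNge; apply/negP => le; apply: no; exists i.
  have tele j : (j <= n)%N -> (j * (#|` S| * #|` ball (2 * n)|) + j <=
      n * (#|` S| * #|` ball (n + j)|))%N.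
    elim: j => // j IH jn; have := IH (ltnW jn).
    have njn : (n + j < 2 * n)%N by rewrite mul2n -addnn ltn_add2l.
    have := big (n + j)%N (leq_addr _ _) njn.
    have : (#|` S| * #|` ball (n + j)| + bdS (ball (n + j)) S <= #|` S| * #|` ball (n + j).+1|)%N.
      rewrite -[#|` S|]sum1_size !big_distrl /= /bdS -big_split /= big_seq [leqRHS]big_seq.
      by apply: leq_sum => t tS; rewrite !mul1n; apply: ball_bd => //; rewrite addn_gt0 n0.
    rewrite -[(n + j).+1]addnS [(j.+1 * _)%N]mulSn => h1 h2 h3.
    apply: leq_trans _ (leq_mul (leqnn n) h1); rewrite mulnDr.
    move: h2 h3; move: (#|` S| * #|` ball (2 * n)|)%N (n * bdS _ _)%N => Q e.
    by move: (j * Q)%N (n * _)%N => u v; clear; lia.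
  have := tele n (leqnn _); have -> : (n + n = 2 * n)%N by rewrite mul2n addnn.
  by rewrite -[leqRHS]addn0 leq_add2l leqNgt n0.
have i0 : (0 < i)%N by exact: leq_trans ni.
apply: (@le_trans _ _ (c / K * n%:R)%:E).
  by rewrite lee_fin -[leLHS]mulrA ler_wpM2l ?divr_ge0// ?(ltW c0) ?(ltW K0)// mulrC.
have /andP[cB BC] := cC i i0; rewrite -[card_set _]/#|` ball i| in cB BC.
have /andP[_ B2C] := cC (2 * n)%N ltac:(by rewrite muln_gt0); rewrite -[card_set _]/#|` ball (2 * n)| in B2C.
apply: (@profile1_ge_set S (ball i)).
- by rewrite !mulr_ge0// ?invr_ge0 ltW.
- rewrite -cardfs_gt0 -(ltr_nat R); apply: lt_le_trans cB.
  by rewrite mulr_gt0// exprn_gt0// ltr0n.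
- apply: (le_trans BC); apply: (@le_trans _ _ (C * (m `^ d%:R^-1 / q) ^+ d)).
    rewrite ler_wpM2l ?(ltW C0)// lerXn2r ?nnegrE ?divr_ge0 ?powR_ge0//.
    apply: (@le_trans _ _ (2 * n%:R)); first by rewrite -natrM ler_nat ltnW.
    have -> : m `^ d%:R^-1 / q = 2 * (m `^ d%:R^-1 / (2 * q)) by field; rewrite gt_eqF.
    by rewrite ler_wpM2l.
  by rewrite expr_div_n !powR_root ?(ltW C0)// mulrCA mulfV ?mulr1// gt_eqF.
apply: le_trans cB; apply: (@le_trans _ _ (c * n%:R ^+ d)); last first.
  by rewrite ler_wpM2l ?(ltW c0)// lerXn2r ?nnegrE// ler_nat.
have {}ile : n%:R * (bdS (ball i) S)%:R <= s * (C * (2 * n%:R) ^+ d).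
  rewrite -natrM; apply: (@le_trans _ _ (s * #|` ball (2 * n)|%:R)); first by rewrite -natrM ler_nat.
  by rewrite ler_wpM2l// (le_trans B2C)// natrM.
have -> : 2 * (c / K * n%:R) * (bdS (ball i) S)%:R = 2 * c / K * (n%:R * (bdS (ball i) S)%:R) by ring.
apply: (le_trans (ler_wpM2l _ ile)); first by rewrite divr_ge0 ?mulr_ge0// ltW.
have -> : 2 * c / K * (s * (C * (2 * n%:R) ^+ d)) = c * n%:R ^+ d * (s / (s + 1)).
  by rewrite /K exprMn; field; rewrite !gt_eqF// ?exprn_gt0.
rewrite ler_piMr ?mulr_ge0 ?exprn_ge0//; first exact: ltW.
by rewrite ler_pdivrMr// mul1r lerDl.
Unshelve. all: by end_near. Qed.

End PolynomialGrowth.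

End ProfileBounds.

(** * Asymptotics *)

Section Domination.
Variable R : realType.
Implicit Types (f g h : R -> \bar R) (u : R -> R).

(** Unlike [asymp_le] it allows no dilation of the argument, so it composes with [ln]; the condition
    [0 <= f x] disposes of absolute values. *)
Definition dominated f g : Prop :=
  exists2 C : R, 0 < C & \forall x \near +oo, (0 <= f x <= C%:E * g x)%E.

Lemma dominated_trans g f h : dominated f g -> dominated g h -> dominated f h.
Proof.
move=> [C C0 fg] [D D0 gh]; exists (C * D); first by rewrite mulr_gt0.
near=> x.
have /andP[f0 fgx] : (0 <= f x <= C%:E * g x)%E by near: x.
have /andP[_ ghx] : (0 <= g x <= D%:E * h x)%E by near: x.
rewrite f0 (le_trans fgx)// EFinM -muleA lee_wpmul2l// lee_fin; exact: ltW.
Unshelve. all: by end_near. Qed.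

Lemma dominated_comp u f g : u x @[x --> +oo] --> +oo -> dominated f g ->
  dominated (f \o u) (g \o u).
Proof. by move=> uy [C C0 fg]; exists C => //; apply: uy fg. Qed.

Lemma dominated_le f g : (\forall x \near +oo, (0 <= f x <= g x)%E) -> dominated f g.
Proof.
by move=> fg; exists 1 => //; apply: filterS fg => x; rewrite mul1e.
Qed.

Lemma dominated_asymp f g : dominated f g -> asymp_le f g.
Proof.
move=> [C C0 fg]; exists 1; split=> //; exists C; split=> //.
apply: filterS fg => x /andP[f0 fgx]; rewrite mul1r gee0_abs//.
by rewrite (le_trans fgx)// lee_wpmul2l ?lee_fin ?(ltW C0)// lee_abs.
Qed.

Lemma bigO_dominated f g : (\forall x \near +oo, (0 <= f x)%E) ->
  (\forall x \near +oo, (0 <= g x)%E) -> bigO_pinfty f g -> dominated f g.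
Proof.
move=> f0 g0 [C [C0 fg]]; exists C => //; near=> x.
have fx : (0 <= f x)%E by near: x.
have gx : (0 <= g x)%E by near: x.
have : (`|f x| <= C%:E * `|g x|)%E by near: x.
by rewrite !gee0_abs// => ->; rewrite fx.
Unshelve. all: by end_near. Qed.

Lemma near_ge u (M : R) : u x @[x --> +oo] --> +oo -> \forall x \near +oo, M <= u x.
Proof. by move=> /cvgryPge. Qed.

Lemma near_gt u (M : R) : u x @[x --> +oo] --> +oo -> \forall x \near +oo, M < u x.
Proof. by move=> /cvgryPgt. Qed.

Lemma cvg_ln_pinfty : ln x @[x --> (+oo : set_system R)] --> +oo.
Proof.
apply/cvgryPge => A; near=> x.
have xA : expR A <= x by near: x; apply: nbhs_pinfty_ge; rewrite num_real.
by rewrite -[A]expRK ler_ln// posrE ?expR_gt0// (lt_le_trans _ xA)// expR_gt0.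
Unshelve. all: by end_near. Qed.

Lemma cvg_ln_ln_pinfty : ln (ln x) @[x --> (+oo : set_system R)] --> +oo.
Proof. exact: (cvg_comp _ _ cvg_ln_pinfty cvg_ln_pinfty). Qed.

Lemma cvg_iter_ln_pinfty n : iter n (@ln R) x @[x --> +oo] --> +oo.
Proof.
elim: n => [|n IH]; first by [].
exact: (cvg_comp _ _ IH cvg_ln_pinfty).
Qed.

Lemma cvg_mulr_pinfty (c : R) : 0 < c -> c * x @[x --> +oo] --> +oo.
Proof.
move=> c0; apply/cvgryPge => A; near=> x.
rewrite mulrC -ler_pdivrMr//; near: x; apply: nbhs_pinfty_ge; rewrite num_real//.
Unshelve. all: by end_near. Qed.

Lemma ln_le_id (x : R) : 0 < x -> ln x <= x.
Proof.
move=> x0; have := @le_ln1Dx R (x - 1); rewrite subrKC => /(_ _)/le_trans; apply; first by lra.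
by lra.
Qed.

Lemma sqrt_le_div_ln (y : R) : 1 < y -> Num.sqrt y / 2 <= y / ln y.
Proof.
move=> y1; have y0 : 0 < y := lt_trans ltr01 y1.
have s0 : 0 < Num.sqrt y by rewrite sqrtr_gt0.
have l0 : 0 < ln y by rewrite ln_gt0.
have E : Num.sqrt y * Num.sqrt y = y by rewrite -expr2 sqr_sqrtr// ltW.
have : ln y <= 2 * Num.sqrt y.
  rewrite -{1}E lnM ?posrE//; have := ln_le_id s0; lra.
rewrite ler_pdivlMr// mulrAC ler_pdivrMr// => le.
have -> : y * 2 = Num.sqrt y * (2 * Num.sqrt y) by rewrite mulrCA E mulrC.
by rewrite ler_wpM2l// ltW.
Qed.

Lemma cvg_div_ln_pinfty : x / ln x @[x --> (+oo : set_system R)] --> +oo.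
Proof.
apply/cvgryPge => A; near=> x.
have x1 : 1 < x by near: x; apply: nbhs_pinfty_gt; rewrite num_real.
have xA : (2 * A) ^+ 2 <= x by near: x; apply: nbhs_pinfty_ge; rewrite num_real.
apply: le_trans (sqrt_le_div_ln x1); rewrite ler_pdivlMr// mulrC.
by rewrite (le_trans (ler_norm _))// -sqrtr_sqr ler_wsqrtr.
Unshelve. all: by end_near. Qed.

(** An approximate inverse of [n -> (D n)^(D n)]: for [n <= lnq D x] and large [x],
    [D n <= ln x / ln (ln x)], so that [D n ln (D n) <= ln x]. *)
Definition lnq (D x : R) : R := ln x / (D * ln (ln x)).

Lemma lnqE D x : 0 < D -> lnq D x = D^-1 * (ln x / ln (ln x)).
Proof. by move=> D0; rewrite /lnq invfM mulrCA. Qed.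

Lemma cvg_lnq_pinfty D : 0 < D -> lnq D x @[x --> +oo] --> +oo.
Proof.
move=> D0; have -> : lnq D = (fun x => D^-1 * x) \o ((fun x => x / ln x) \o @ln R).
  by apply/funext => x; rewrite lnqE.
apply: (cvg_comp _ _ (cvg_comp _ _ cvg_ln_pinfty cvg_div_ln_pinfty)).
by apply: cvg_mulr_pinfty; rewrite invr_gt0.
Qed.

Lemma lnq_le_ln D : 0 < D -> \forall x \near +oo, lnq D x <= ln x.
Proof.
move=> D0; near=> x.
have lD : D^-1 <= ln (ln x).
  by near: x; exact: (near_ge _ cvg_ln_ln_pinfty).
have l0 : 0 <= ln x by near: x; exact: (near_ge _ cvg_ln_pinfty).
have l1 : 0 < ln (ln x) by apply: lt_le_trans lD; rewrite invr_gt0.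
rewrite /lnq ler_pdivrMr ?mulr_gt0// ler_peMr//.
by rewrite -(mulfV (lt0r_neq0 D0)) ler_wpM2l// ltW.
Unshelve. all: by end_near. Qed.

Lemma iter_ln_lnq_le D n : 0 < D ->
  \forall x \near +oo, iter n (@ln R) (lnq D x) <= iter n.+1 (@ln R) x.
Proof.
move=> D0; elim: n => [|n IH]; first exact: lnq_le_ln.
near=> x; have le : iter n (@ln R) (lnq D x) <= iter n.+1 (@ln R) x by near: x.
have pos : 0 < iter n (@ln R) (lnq D x).
  by near: x; exact: (near_gt _ (cvg_comp _ _ (cvg_lnq_pinfty D0) (cvg_iter_ln_pinfty n))).
by rewrite iterS [iter n.+2 _ _]iterS ler_ln ?posrE// (lt_le_trans pos).
Unshelve. all: by end_near. Qed.

(** The first outer logarithm turns the denominator into a bounded factor: with [y = ln x],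
    [lnq D x] is at least the square root of [y] over [2 D], whose logarithm is at least [ln y / 4].
    The factor 1/4 then survives each further logarithm, because [ln (z / 4) >= ln z / 4] for large
    [z]. *)
Lemma iter_ln_lnq_ge D n : 0 < D -> (0 < n)%N ->
  \forall x \near +oo, 4^-1 * iter n.+1 (@ln R) x <= iter n (@ln R) (lnq D x).
Proof.
move=> D0; case: n => // n _; elim: n => [|n IH]; near=> x.
  rewrite /=.
  have y1 : 1 < ln x by near: x; exact: (near_gt _ cvg_ln_pinfty).
  have yD : 4 * ln (2 * D) <= ln (ln x).
    by near: x; exact: (near_ge _ cvg_ln_ln_pinfty).
  set y := ln x in y1 yD *.
  have y0 : 0 < y := lt_trans ltr01 y1.
  have s0 : 0 < Num.sqrt y by rewrite sqrtr_gt0.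
  have lE : ln (Num.sqrt y) = ln y / 2.
    have : ln y = ln (Num.sqrt y) + ln (Num.sqrt y).
      by rewrite -lnM ?posrE// -expr2 sqr_sqrtr// ltW.
    by lra.
  have D2 : 0 < 2 * D by rewrite mulr_gt0.
  have : Num.sqrt y / (2 * D) <= lnq D x.
    rewrite lnqE// invfM [D^-1 * _]mulrC mulrA ler_wpM2r ?invr_ge0 ?(ltW D0)//.
    exact: sqrt_le_div_ln.
  move=> le; have sD : 0 < Num.sqrt y / (2 * D) by rewrite divr_gt0.
  apply: (@le_trans _ _ (ln (Num.sqrt y / (2 * D)))).
    by rewrite ln_div ?posrE// lE; lra.
  by rewrite ler_ln ?posrE// (lt_le_trans sD).
have le : 4^-1 * iter n.+2 (@ln R) x <= iter n.+1 (@ln R) (lnq D x) by near: x.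
have z1 : expR (2 * ln 4) <= iter n.+2 (@ln R) x.
  by near: x; exact: (near_ge _ (cvg_iter_ln_pinfty _)).
rewrite [iter n.+2 _ (lnq _ _)]iterS [iter n.+3 _ _]iterS.
move: (iter n.+2 _ _) (iter n.+1 _ _) z1 le => z w z1 le.
have z0 : 0 < z := lt_le_trans (expR_gt0 _) z1.
have lz : 2 * ln 4 <= ln z by rewrite -[2 * _]expRK ler_ln ?posrE ?expR_gt0.
have z4 : 0 < 4^-1 * z by rewrite mulr_gt0.
apply: (@le_trans _ _ (ln (4^-1 * z))); last by rewrite ler_ln ?posrE// (lt_le_trans z4).
have l4 : 0 <= ln 4 :> R by rewrite ln_ge0//; lra.
by rewrite lnM ?posrE// lnV ?posrE//; lra.
Unshelve. all: by end_near. Qed.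

End Domination.

(** * Logarithmic bounds for one extension *)

Section AsymptoticBounds.
Variables (R : realType) (K G : groupType) (SK : {fset K}) (SP : {fset G}).
Hypothesis ext : extension_bounds R K SP.
Implicit Types (p x : R).

Lemma profile_trunc (T : groupType) (S : {fset T}) p x : 0 <= x ->
  (profile p S x <= profile p S (Num.trunc x)%:R)%E.
Proof.
move=> x0; apply: ereal_sup_le => _ [f [f0 fn ff fx] <-].
by exists f => //; split => //; rewrite ler_nat truncn_ge_nat.
Qed.

Lemma near_profile_ge0 (T : groupType) (S : {fset T}) p (u : R -> R) : 1 <= p ->
  u x @[x --> +oo] --> +oo -> \forall x \near +oo, (0 <= profile p S (u x))%E.
Proof.
move=> p1 uy; near=> x; apply: profile_ge0 => //.
by near: x; exact: (near_ge _ uy).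
Unshelve. all: by end_near. Qed.

Lemma profile_extension_ge p : 1 <= p -> generates SK ->
  exists2 D : R, 0 < D & dominated (fun x => profile p SK (lnq D x)) (profile p SP).
Proof.
move=> p1 gSK; have [_ /(_ p SK p1 gSK)[C [D [C0 D0 CD]]] _] := ext.
have DR : 0 < D%:R :> R by rewrite ltr0n.
exists D%:R => //; exists C => //; near=> x.
apply/andP; split.
  by near: x; apply: near_profile_ge0 => //; exact: cvg_lnq_pinfty.
have q1 : 1 <= lnq D%:R x.
  by near: x; exact: (near_ge _ (cvg_lnq_pinfty DR)).
apply: (le_trans (profile_trunc SK p _)); first exact: le_trans q1.
apply: CD; set n := Num.trunc (lnq D%:R x).
have x0 : 0 < x by near: x; apply: nbhs_pinfty_gt; rewrite num_real.
have n0 : (0 < n)%N by rewrite truncn_gt0.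
have ll1 : 1 <= ln (ln x).
  by near: x; exact: (near_ge _ (@cvg_ln_ln_pinfty R)).
have ll0 : 0 < ln (ln x) := lt_le_trans ltr01 ll1.
have l0 : 0 < ln x by near: x; exact: (near_gt _ (@cvg_ln_pinfty R)).
have Dn : (D * n)%:R <= ln x / ln (ln x).
  rewrite natrM; have : n%:R <= lnq D%:R x by rewrite truncn_le (le_trans ler01).
  by rewrite lnqE// [D%:R * _]mulrC -ler_pdivlMr// mulrC.
have Dn0 : 0 < (D * n)%:R :> R by rewrite ltr0n muln_gt0 D0.
rewrite natrX -[_ ^+ _](lnK (_ : _ \is Num.pos)) ?posrE ?exprn_gt0//.
rewrite -[leRHS](lnK (_ : _ \is Num.pos)) ?posrE// ler_expR lnXn// -[leLHS]mulr_natl.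
apply: (@le_trans _ _ ((ln x / ln (ln x)) * ln (ln x))); last by rewrite divfK ?gt_eqF.
apply: ler_pM => //; first by rewrite ln_ge0// ler1n muln_gt0 D0.
rewrite ler_ln ?posrE// (le_trans Dn)// ler_pdivrMr// ler_peMr// ltW//.
Unshelve. all: by end_near. Qed.

Lemma unbounded_profile_extension : generates SK ->
  unbounded_profile R SK -> unbounded_profile R SP.
Proof.
move=> gSK unb M; have [_ /(_ 1 SK (lexx 1) gSK)[C [D [C0 D0 CD]]] _] := ext.
have [x xP] := unb (C * M); pose n := (Num.trunc x).+1.
exists ((D * n) ^ (D * n))%:R; rewrite -(@lee_pmul2l _ C%:E) ?lte_fin//.
apply: le_trans (CD n _ (lexx _)); rewrite -EFinM (le_trans xP)//.
by apply: profile_mono; rewrite ltW// truncnS_gt.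
Qed.

Lemma profile1_extension_le : generates SK -> unbounded_profile R SK ->
  dominated (profile 1 SP) (fun x => profile 1 SK (ln x)).
Proof.
move=> gSK unb; have [_ _ /(_ SK)[C C0 CP]] := ext.
have [C1 C10 C1P] := isoper_profile SP (lexx (1 : R)).
have [[x0 x0P]|fin] := pselect (exists x0 : R, profile 1 SK x0 = +oo%E).
  exists 1 => //; near=> x.
  have -> : profile 1 SK (ln x) = +oo%E.
    apply/eqP; rewrite -leye_eq -x0P profile_mono//.
    by near: x; exact: (near_ge _ (@cvg_ln_pinfty R)).
  rewrite mul1e leey andbT; near: x; exact: (near_profile_ge0 _ (lexx _) (@cvg_id _ _)).
have inf : infinite_set [set: K] by move=> /(@profile1_finite_pinfty R K SK).
(* With [m = ln x] and [k > ln x / 16 - 1], a base above [exp 32] gives [b ^ k > exp (2 ln x - 32)],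
   which exceeds [x] as soon as [ln x >= 33]. The set [B] has one spare element because the identity
   is removed. *)
pose b := (Num.trunc (expR (32 : R))).+1.
have [B0 _ B0b] := infinite_set_fset (8 * b).+1 inf.
pose B := (B0 `\ 1%g)%fset.
have Bb : (8 * b <= #|` B|)%N.
  by move: B0b; rewrite (cardfsD1 1%g B0) -/B; case: (_ \in _); rewrite ?add1n ?add0n// => /ltnW.
have [n nP] := word_ball_bounded (enum_fset B) gSK.
(* Beyond [x1] the profile exceeds the radius [n] of [B] and is positive. *)
have [x1 x1P] := unb (n%:R + 1).
exists (C1 * C); first by rewrite mulr_gt0.
near=> x; apply/andP; split; first by near: x; exact: (near_profile_ge0 _ (lexx _) (@cvg_id _ _)).
have lx1 : x1 <= ln x.
  by near: x; exact: (near_ge _ (@cvg_ln_pinfty R)).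
have l33 : 33 <= ln x.
  by near: x; exact: (near_ge _ (@cvg_ln_pinfty R)).
have x0 : 0 < x by near: x; apply: nbhs_pinfty_gt; rewrite num_real.
have := le_trans x1P (profile_mono 1 SK lx1).
case E : (profile 1 SK (ln x)) => [r||] //; last first.
  by rewrite gt0_muley ?leey// lte_fin mulr_gt0.
rewrite lee_fin => nr.
have r0 : 0 < r by apply: lt_le_trans nr; rewrite ltr_wpDl.
rewrite -EFinM -mulrA; apply: C1P; first by rewrite mulr_gt0.
have ly : 0 <= ln x / 16 by rewrite divr_ge0//; lra.
apply: (CP (ln x) r x n b (Num.trunc (ln x / 16)) B) => //.
- by apply: le_trans nr; rewrite lerDl.
- by apply: profile1_isoper; [exact: ltW | rewrite E].
- by rewrite natrM mulrC -ler_pdivlMr// truncn_le.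
- move=> y yB; split; last exact: nP.
  by move: yB; rewrite in_fsetD1 => /andP[].
set k := Num.trunc _.
have kge : ln x / 16 < k%:R + 1 by rewrite natr1 truncnS_gt.
rewrite -[ltLHS](lnK (_ : _ \is Num.pos)) ?posrE//.
apply: (@lt_le_trans _ _ (expR (32 *+ k))).
  by rewrite ltr_expR -mulr_natr; lra.
rewrite -mulr_natr expRM_natr natrX lerXn2r ?nnegrE ?expR_ge0// ltW//.
exact: truncnS_gt.
Unshelve. all: by end_near. Qed.

Lemma profile1_extension_le_poly d : (1 <= d)%N -> polynomial_growth R SK d ->
  dominated (profile 1 SP) (fun x => ((ln x / ln (ln x)) `^ d%:R^-1)%:E).
Proof.
move=> d1 gr; have [_ _ /(_ SK)[C C0 CP]] := ext.
have [C1 C10 C1P] := isoper_profile SP (lexx (1 : R)).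
have [C2 C20 C2P] := poly_growth_isoper d1 gr.
have [c [C4 [c0 _ cB]]] := gr.
have d0 : 0 < d%:R :> R by rewrite ltr0n.
pose C3 := Num.max C2 1; have C30 : 0 < C3 by rewrite lt_max C20.
(* Truncation at worst halves the radius [g >= 1], which costs a factor [2 ^+ d] in volume. *)
pose e := c / 2 ^+ d; have e0 : 0 < e by rewrite divr_gt0// exprn_gt0.
(* With [m = 256 y / ln y], [k >= m / 32] and [ln b >= ln y / 4], one gets [k ln b >= 2 y > ln x],
   where [y = ln x]. *)
have [M M0 ME] : exists2 M : R, 0 < M & M = 256 by exists 256; [rewrite ltr0n|reflexivity].
exists (C1 * (C * (C3 * M `^ d%:R^-1))); first by rewrite !mulr_gt0// powR_gt0.
near=> x; apply/andP; split; first by near: x; exact: (near_profile_ge0 _ (lexx _) (@cvg_id _ _)).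
have x0 : 0 < x by near: x; apply: nbhs_pinfty_gt; rewrite num_real.
have y1 : 1 < ln x by near: x; exact: (near_gt _ (@cvg_ln_pinfty R)).
have wbig : (24 / e + 6) ^+ 2 / M <= ln x / ln (ln x).
  by near: x; exact: (near_ge _ (cvg_comp _ _ (@cvg_ln_pinfty R) (@cvg_div_ln_pinfty R))).
set y := ln x in y1 wbig *.
have y0 : 0 < y := lt_trans ltr01 y1.
have ly0 : 0 < ln y by rewrite ln_gt0.
have sy := sqrt_le_div_ln y1.
set w := y / ln y in sy *; pose m := M * w.
have s0 : 0 < Num.sqrt y by rewrite sqrtr_gt0.
have w0 : 0 < w by rewrite divr_gt0.
have m0 : 0 < m by rewrite mulr_gt0.
have mbig : (24 / e + 6) ^+ 2 <= m.
  by move: wbig; rewrite -/w ler_pdivrMr// [w * M]mulrC.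
pose t := Num.sqrt m.
have tt : t * t = m by rewrite -expr2 sqr_sqrtr// ltW.
have tbig : 24 / e + 6 <= t.
  have q0 : 0 <= 24 / e + 6 by rewrite addr_ge0// divr_ge0// ltW.
  rewrite -(@ler_pXn2r _ 2)// ?nnegrE ?sqrtr_ge0//.
  by rewrite /t sqr_sqrtr// ltW.
have t6 : 6 <= t by apply: le_trans tbig; rewrite lerDr divr_ge0// ltW.
have te : 24 <= e * t.
  rewrite mulrC -ler_pdivrMr//; apply: le_trans tbig; by rewrite lerDl.
have m32 : 32 <= m by rewrite -tt; nra.
have m1 : 1 <= m by apply: le_trans m32; lra.
pose g := m `^ d%:R^-1.
have g1 : 1 <= g by rewrite -(powRr0 m) ler_powR// invr_ge0 ltW.
pose n := Num.trunc g; pose B := (ball SK n `\ 1%g)%fset.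
have n0 : (0 < n)%N by rewrite truncn_gt0.
have Bge : e * m - 1 <= #|` B|%:R.
  have : e * m <= #|` ball SK n|%:R.
    have /andP[+ _] := cB n n0; apply: le_trans.
    have -> : e * m = c * (g ^+ d / 2 ^+ d).
      by rewrite /g (powR_root d1 (ltW m0)) /e -mulrA [_^-1 * m]mulrC.
    rewrite ler_wpM2l ?(ltW c0)//.
    rewrite ler_pdivrMr ?exprn_gt0// -exprMn lerXn2r ?nnegrE ?mulr_ge0 ?powR_ge0//.
    have : g < n%:R + 1 by rewrite natr1 truncnS_gt.
    have : 1 <= n%:R :> R by rewrite ler1n.
    by rewrite -/g; lra.
  rewrite (cardfsD1 1%g (ball SK n)) -/B natrD.
  have : (1%g \in ball SK n)%:R <= 1 :> R by rewrite lern1 leq_b1.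
  by lra.
(* Although [b] is proportional to [m], only [b >= t], the square root of [m], is kept: the
   logarithm merely loses a factor 2. *)
pose b := Num.trunc ((e * m - 1) / 8).
have etm : e * m = e * t * t by rewrite -mulrA tt.
have bt : t <= b%:R.
  have : (e * m - 1) / 8 < b%:R + 1 by rewrite natr1 truncnS_gt.
  rewrite etm; nra.
have b8 : (8 * b <= #|` B|)%N.
  rewrite -(ler_nat R); apply: le_trans Bge; rewrite natrM mulrC -ler_pdivlMr// truncn_le.
  by rewrite divr_ge0// etm; nra.
pose k := Num.trunc (m / 16).
have k16 : (16 * k)%:R <= m.
  by rewrite natrM mulrC -ler_pdivlMr// truncn_le divr_ge0// ltW.
have km : m / 32 <= k%:R.
  by have : m / 16 < k%:R + 1 by [rewrite natr1 truncnS_gt]; lra.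
apply: (@le_trans _ _ (C1 * (C * (C3 * g)))%:E); last first.
  by rewrite -EFinM lee_fin /g /m powRM ?(ltW w0) ?(ltW M0)// !mulrA.
apply: C1P; first by rewrite !mulr_gt0// (lt_le_trans ltr01 g1).
apply: (CP m (C3 * g) x n b k B) => //.
- apply: (@le_trans _ _ g); first by rewrite truncn_le (le_trans ler01).
  by rewrite ler_peMl ?(le_trans ler01 g1)// le_max lexx orbT.
- apply: isoperS (C2P m m1); rewrite ler_wpM2r ?(le_trans ler01 g1)//.
  by rewrite le_max lexx.
- by rewrite -(ltr_nat R); apply: lt_le_trans bt; lra.
- move=> z; rewrite in_fsetD1 => /andP[z1 zB]; split => //.
  exact/(ballP gr _ n0).
rewrite -[ltLHS](lnK (_ : _ \is Num.pos)) ?posrE// -/y.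
have t0 : 0 < t by lra.
have lnt : ln y / 4 <= ln t.
  have : ln t + ln t = ln m by rewrite -lnM ?posrE// tt.
  have : ln (Num.sqrt y) <= ln m by rewrite ler_ln ?posrE// /m ME; lra.
  have : ln (Num.sqrt y) + ln (Num.sqrt y) = ln y.
    by rewrite -lnM ?posrE// -expr2 sqr_sqrtr// ltW.
  by lra.
apply: (@lt_le_trans _ _ (expR (ln t * k%:R))).
  rewrite ltr_expR; apply: (@lt_le_trans _ _ (ln y / 4 * (m / 32))).
    have -> : ln y / 4 * (m / 32) = 2 * y by rewrite /m /w ME; field; rewrite gt_eqF.
    by lra.
  by rewrite ler_pM// ?divr_ge0// ltW.
rewrite expRM_natr lnK ?posrE// natrX lerXn2r ?nnegrE// ltW//.
Unshelve. all: by end_near. Qed.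

End AsymptoticBounds.

(** * Bounds for iterated extensions *)

Section Iteration.
Variables (R : realType) (p : R) (H : groupType) (SH : {fset H}) (P : groupType -> groupType).
Hypothesis p1 : 1 <= p.
Hypothesis gSH : generates SH.
Hypothesis am : amenable R H.
Hypothesis ext : forall (K : groupType) (SP : {fset P K}), generates SP -> extension_bounds R K SP.

Let near_id_ge0 (T : groupType) (S : {fset T}) (q : R) : 1 <= q ->
  \forall x \near (+oo : set_system R), (0 <= profile q S x)%E.
Proof. by move=> q1; exact: (near_profile_ge0 _ q1 (@cvg_id _ _)). Qed.

Lemma profile_dominated_generates (T : groupType) (S S' : {fset T}) (q : R) : 1 <= q ->
  generates S -> dominated (profile q S) (profile q S').
Proof.
move=> q1 gS; have [C C0 CP] := profile_generates S' q1 gS.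
by exists C => //; apply: filterS (near_id_ge0 S q1) => x ->; exact: CP.
Qed.

Lemma profile_dominated_profile1 (T : groupType) (S : {fset T}) :
  dominated (profile p S) (profile 1 S).
Proof.
have [C C0 CP] := profile_le_profile1 S p1.
exists C => //; near=> x; apply/andP; split.
  by near: x; exact: near_id_ge0.
by apply: CP; near: x; apply: nbhs_pinfty_ge; rewrite num_real.
Unshelve. all: by end_near. Qed.

Lemma profile_asymp_dominated (T : groupType) (S : {fset T}) (q q' : R) : 1 <= q -> 1 <= q' ->
  asymp_le (profile q S) (profile q' S) ->
  exists2 C, 0 < C & dominated (profile q S) (fun x => profile q' S (C * x)).
Proof.
move=> q1 q'1 [C [C0 le]]; exists C => //; apply: bigO_dominated le.
  exact: near_id_ge0.
by apply: near_profile_ge0 => //; exact: cvg_mulr_pinfty.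
Qed.

Lemma iter_unbounded n (SP : {fset iter n P H}) : generates SP -> unbounded_profile R SP.
Proof.
elim: n SP => [|n IH] SP gSP; first exact: amenable_unbounded.
have [[SK gSK] _ _] := ext gSP.
exact: (unbounded_profile_extension (ext gSP) gSK (IH SK gSK)).
Qed.

Lemma profile1_iter_le n (SP : {fset iter n P H}) : generates SP ->
  dominated (profile 1 SP) (fun x => profile 1 SH (iter n (@ln R) x)).
Proof.
elim: n SP => [|n IH] SP gSP; first exact: profile_dominated_generates.
have [[SK gSK] _ _] := ext gSP.
apply: (dominated_trans (profile1_extension_le (ext gSP) gSK (iter_unbounded gSK))).
have := dominated_comp (@cvg_ln_pinfty R) (IH SK gSK).
by congr dominated; apply/funext => x; rewrite /= -iterSr.
Qed.

Lemma profile1_iter_le_poly d n (SP : {fset iter n.+1 P H}) : (1 <= d)%N ->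
  polynomial_growth R SH d -> generates SP ->
  dominated (profile 1 SP)
    (fun x => ((iter n.+1 (@ln R) x / iter n.+2 (@ln R) x) `^ d%:R^-1)%:E).
Proof.
move=> d1 gr; elim: n SP => [|n IH] SP gSP.
  exact: (profile1_extension_le_poly (ext gSP) d1 gr).
have [[SK gSK] _ _] := ext gSP.
apply: (dominated_trans (profile1_extension_le (ext gSP) gSK (iter_unbounded (n := n.+1) gSK))).
have := dominated_comp (@cvg_ln_pinfty R) (IH SK gSK).
by congr dominated; apply/funext => x; rewrite /= -!iterSr.
Qed.

Lemma star_dominated D : assumption_star (profile p SH) -> 0 < D ->
  dominated (fun x => profile p SH (D * x)) (profile p SH).
Proof.
move=> star D0; apply: bigO_dominated (star D D0); last exact: near_id_ge0.
by apply: near_profile_ge0 => //; exact: cvg_mulr_pinfty.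
Qed.

Lemma star_dominated_lnq D : assumption_star (profile p SH) -> 0 < D ->
  dominated (fun x => profile p SH (ln x / ln (ln x))) (fun x => profile p SH (lnq D x)).
Proof.
move=> star D0; have := dominated_comp (cvg_lnq_pinfty D0) (star_dominated star D0).
congr dominated; apply/funext => x /=.
by rewrite lnqE// mulrA mulfV ?mul1r// gt_eqF.
Qed.

(** Removes the dilation from [asymp_le]: [ln (C x) >= ln x / 2] for large [x], so the argument is
    at most [2 C] times [x / ln x], and Assumption star absorbs [2 C]. *)
Lemma profile_dominated_div_ln : assumption_star (profile p SH) ->
  asymp_le (profile p SH) (fun x => profile p SH (x / ln x)) ->
  dominated (profile p SH) (fun x => profile p SH (x / ln x)).
Proof.
move=> star [C [C0 le]].
have cvgC : C * x / ln (C * x) @[x --> (+oo : set_system R)] --> +oo.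
  exact: (cvg_comp _ _ (cvg_mulr_pinfty C0) (@cvg_div_ln_pinfty R)).
have C20 : 0 < 2 * C by rewrite mulr_gt0.
have le1 : dominated (profile p SH) (fun x => profile p SH (C * x / ln (C * x))).
  by apply: bigO_dominated le; [exact: near_id_ge0 | exact: near_profile_ge0].
apply: (dominated_trans le1).
apply: (@dominated_trans _ (fun x => profile p SH (2 * C * (x / ln x)))); last first.
  exact: (dominated_comp (@cvg_div_ln_pinfty R) (star_dominated star C20)).
apply: dominated_le; near=> x; apply/andP; split.
  by near: x; exact: near_profile_ge0.
apply: profile_mono.
have x1 : 1 < x by near: x; apply: nbhs_pinfty_gt; rewrite num_real.
have x0 : 0 < x := lt_trans ltr01 x1.
have lx : 0 < ln x by rewrite ln_gt0.
have lC : - (2 * ln C) <= ln x by near: x; exact: (near_ge _ (@cvg_ln_pinfty R)).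
have half : ln x / 2 <= ln (C * x) by rewrite lnM ?posrE//; lra.
have l2 : 0 < ln x / 2 by rewrite divr_gt0.
have -> : 2 * C * (x / ln x) = C * x / (ln x / 2) by field; rewrite gt_eqF.
rewrite ler_wpM2l ?mulr_ge0 ?(ltW C0) ?(ltW x0)//.
by rewrite lef_pV2 ?posrE// (lt_le_trans l2).
Unshelve. all: by end_near. Qed.

Lemma profile_iter_ge n (SP : {fset iter n P H}) : generates SP ->
  assumption_star (profile p SH) ->
  dominated (profile p SH) (fun x => profile p SH (x / ln x)) ->
  dominated (fun x => profile p SH (iter n (@ln R) x)) (profile p SP).
Proof.
move=> gSP star div; elim: n SP gSP => [|n IH] SP gSP.
  exact: profile_dominated_generates.
have [[SK gSK] _ _] := ext gSP.
have [D D0 ge] := profile_extension_ge (ext gSP) p1 gSK.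
apply: (dominated_trans _ ge).
apply: (dominated_trans _ (dominated_comp (cvg_lnq_pinfty D0) (IH SK gSK))).
(* Directly above [H] the loss of [ln (ln x)] is absorbed by the hypothesis on [x / ln x]; higher up
   only a factor 4 is lost, which Assumption star absorbs. *)
case: n {IH SP gSP SK gSK ge} => [|n].
  apply: (dominated_trans (dominated_comp (@cvg_ln_pinfty R) div)).
  exact: star_dominated_lnq.
have four0 : 0 < 4 :> R by [].
have cvgn : 4^-1 * iter n.+2 (@ln R) x @[x --> (+oo : set_system R)] --> +oo.
  apply: (cvg_comp _ _ (@cvg_iter_ln_pinfty R n.+2)).
  by apply: cvg_mulr_pinfty; rewrite invr_gt0.
apply: (@dominated_trans _ (fun x => profile p SH (4^-1 * iter n.+2 (@ln R) x))).
  have := dominated_comp cvgn (star_dominated star four0).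
  by congr dominated; apply/funext => x /=; rewrite mulrA mulfV ?mul1r.
apply: dominated_le; near=> x; apply/andP; split.
  by near: x; exact: near_profile_ge0.
by apply: profile_mono; near: x; exact: iter_ln_lnq_ge.
Unshelve. all: by end_near. Qed.

(** Homogeneity of the power takes over the role of Assumption star: the dilation [C] comes out as
    the factor [C^(1/d)]. *)
Lemma powR_dominated_profile d : (1 <= d)%N -> polynomial_growth R SH d ->
  asymp_le (profile 1 SH) (profile p SH) ->
  dominated (fun x => (x `^ d%:R^-1)%:E) (profile p SH).
Proof.
move=> d1 gr le; have [C C0 domC] := profile_asymp_dominated (lexx 1) p1 le.
have [c c0 cP] := poly_growth_profile_ge d1 gr.
have dom1 : dominated (fun x : R => (x `^ d%:R^-1)%:E) (profile 1 SH).
  have ci0 : 0 < c^-1 by rewrite invr_gt0.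
  exists c^-1 => //.
  near=> x; rewrite lee_fin powR_ge0 /=.
  have : ((c * x `^ d%:R^-1)%:E <= profile 1 SH x)%E by near: x.
  have ci : (0 <= c^-1%:E)%E by rewrite lee_fin invr_ge0 ltW.
  move=> /(lee_wpmul2l ci); apply: le_trans.
  by rewrite -EFinM mulrA mulVf ?mul1r// gt_eqF.
have Ci0 : 0 < C^-1 by rewrite invr_gt0.
have := dominated_comp (cvg_mulr_pinfty Ci0) (dominated_trans dom1 domC).
move=> [B B0 BP]; exists (C `^ d%:R^-1 * B); first by rewrite mulr_gt0// powR_gt0.
near=> x; rewrite lee_fin powR_ge0 /=.
have x0 : 0 <= x by near: x; apply: nbhs_pinfty_ge; rewrite num_real.
have : (((C^-1 * x) `^ d%:R^-1)%:E <= B%:E * profile p SH x)%E.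
  have /andP[_ +] : (0 <= ((C^-1 * x) `^ d%:R^-1)%:E <= B%:E * profile p SH (C * (C^-1 * x)))%E.
    by near: x.
  by rewrite mulrA mulfV ?mul1r// gt_eqF.
have Cp : (0 <= (C `^ d%:R^-1)%:E)%E by rewrite lee_fin powR_ge0.
move=> /(lee_wpmul2l Cp); rewrite muleA -EFinM -EFinM -powRM//; last 2 first.
- exact: ltW.
- by rewrite mulr_ge0// ltW.
by rewrite mulrA mulfV ?mul1r// gt_eqF.
Unshelve. all: by end_near. Qed.

Lemma profile_iter_ge_poly d n (SP : {fset iter n.+1 P H}) : (1 <= d)%N ->
  polynomial_growth R SH d -> asymp_le (profile 1 SH) (profile p SH) -> generates SP ->
  dominated (fun x => ((iter n.+1 (@ln R) x / iter n.+2 (@ln R) x) `^ d%:R^-1)%:E) (profile p SP).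
Proof.
move=> d1 gr le; have dom0 := powR_dominated_profile d1 gr le.
have d0 : 0 <= d%:R^-1 :> R by rewrite invr_ge0.
elim: n SP => [|n IH] SP gSP; have [[SK gSK] _ _] := ext gSP.
  have [D D0 ge] := profile_extension_ge (ext gSP) p1 gSH.
  apply: (dominated_trans _ ge).
  apply: (dominated_trans _ (dominated_comp (cvg_lnq_pinfty D0) dom0)).
  exists (D `^ d%:R^-1); first exact: powR_gt0.
  near=> x; rewrite lee_fin powR_ge0 /= -EFinM lee_fin.
  have q0 : 0 <= lnq D x by near: x; exact: (near_ge _ (cvg_lnq_pinfty D0)).
  by rewrite -powRM ?(ltW D0)// lnqE// mulrA mulfV ?mul1r// gt_eqF.
have [D D0 ge] := profile_extension_ge (ext gSP) p1 gSK.
apply: (dominated_trans _ ge).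
apply: (dominated_trans _ (dominated_comp (cvg_lnq_pinfty D0) (IH SK gSK))).
exists (4 `^ d%:R^-1); first exact: powR_gt0.
near=> x; rewrite lee_fin powR_ge0 /= -EFinM lee_fin.
rewrite -[ln (iter n _ (lnq D x))]/(iter n.+1 (@ln R) (lnq D x)).
rewrite -[ln (ln (iter n _ x))]/(iter n.+2 (@ln R) x).
have h1 : 4^-1 * iter n.+2 (@ln R) x <= iter n.+1 (@ln R) (lnq D x).
  by near: x; exact: iter_ln_lnq_ge.
have h2 : 1 < iter n.+1 (@ln R) (lnq D x).
  by near: x; exact: (near_gt _ (cvg_comp _ _ (cvg_lnq_pinfty D0) (@cvg_iter_ln_pinfty R n.+1))).
have h3 : iter n.+1 (@ln R) (lnq D x) <= iter n.+2 (@ln R) x.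
  by near: x; exact: iter_ln_lnq_le.
move: (iter n.+1 _ _) (iter n.+2 _ _) h1 h2 h3 => w z h1 w1 wz.
have w0 : 0 < w := lt_trans ltr01 w1.
have z1 : 1 < z := lt_le_trans w1 wz.
have lw : 0 < ln w by rewrite ln_gt0.
have lz : 0 < ln z by rewrite ln_gt0.
have z0 : 0 < z := lt_trans ltr01 z1.
rewrite -powRM ?divr_ge0 ?(ltW w0) ?(ltW lw)//.
rewrite ge0_ler_powR ?nnegrE ?mulr_ge0 ?invr_ge0 ?(ltW w0) ?(ltW lw) ?(ltW z0) ?(ltW lz)//.
(* From [z / 4 <= w <= z]: the numerators differ by a factor at most 4 and [ln w <= ln z], hence
   [z / ln z <= 4 w / ln w]. *)
rewrite mulrA ler_pM ?invr_ge0 ?(ltW z0) ?(ltW lz)//; first by lra.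
by rewrite lef_pV2 ?posrE// ler_ln ?posrE.
Unshelve. all: by end_near. Qed.

End Iteration.

Theorem corollaryF (R : realType) (p : R) (hp : 1 <= p)
    (H : groupType) (SH : {fset H}) (hSH : generates SH) (hH : amenable R H)
    (s : nat) (hs : (1 <= s)%N)
    (F : finGroupType) (hF : (1 < #|F|)%N)
    (P : groupType -> groupType) (hP : P = Shuffler s \/ P = Designer F) :
  (assumption_star (profile p SH) ->
   forall SP : {fset P H}, generates SP ->
     asymp_le (fun x : R => profile p SH (ln x / ln (ln x))) (profile p SP) /\
     asymp_le (profile p SP) (fun x : R => profile 1 SH (ln x)))
  /\
  (forall n : nat, asymp_eq (profile p SH) (profile 1 SH) ->
   forall SP : {fset iter n P H}, generates SP ->
     (forall d : nat, (1 <= d)%N -> polynomial_growth R SH d -> (1 <= n)%N ->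
        asymp_eq (profile p SP)
          (fun x : R =>
             ((iter n (@ln R) x / iter n.+1 (@ln R) x) `^ (d%:R^-1))%:E)) /\
     (assumption_star (profile p SH) ->
      asymp_eq (fun x : R => profile p SH (x / ln x)) (profile p SH) ->
        asymp_eq (profile p SP)
          (fun x : R => profile p SH (iter n (@ln R) x)))).
Proof.
have ext (K : groupType) (SP : {fset P K}) : generates SP -> extension_bounds R K SP.
  case: hP SP => -> SP; first exact: Shuffler_extension_bounds.
  exact: Designer_extension_bounds.
split=> [star SP gSP|n [pj1 j1p] SP gSP].
  split; apply: dominated_asymp.
    have [D D0 ge] := profile_extension_ge (ext H SP gSP) hp hSH.
    exact: dominated_trans (star_dominated_lnq hp star D0) ge.
  apply: dominated_trans (profile_dominated_profile1 hp SP) _.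
  exact: (@profile1_iter_le R H SH P hH ext 1 SP gSP).
split=> [d d1 gr n1|star [_ div]].
  case: n n1 SP gSP => // n _ SP gSP; split; apply: dominated_asymp.
    apply: dominated_trans (profile_dominated_profile1 hp SP) _.
    exact: (profile1_iter_le_poly hH ext d1 gr gSP).
  exact: (profile_iter_ge_poly hp hSH ext d1 gr j1p gSP).
split; apply: dominated_asymp; last first.
  exact: profile_iter_ge (profile_dominated_div_ln hp star div).
apply: dominated_trans (profile_dominated_profile1 hp SP) _.
apply: (dominated_trans (profile1_iter_le SH hH ext gSP)).
(* The return from exponent 1 to [p] takes place in [H], where Assumption star absorbs the dilation
   [C], before composing with the iterated logarithm. *)
have [C C0 dom] := profile_asymp_dominated (lexx 1) hp j1p.
have := dominated_trans dom (star_dominated hp star C0).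
exact: dominated_comp (@cvg_iter_ln_pinfty R n).
Qed.
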